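(* Let $p\geq 2$ be an integer and let $G$ be a finite simple graph with $n\geq 1$ vertices satisfying property $N_{2,p}$. Then \[\mathrm{reg}(G)\leq\log_{\frac{p+4}{2}}\frac{n}{p+1}+4.\]
   Context: All graphs are finite and simple. Fix a field $k$ of characteristic $0$. For a graph $G$ with vertex set $[n]$, the non-edge ideal is $I(G)=\langle x_ix_j : i\neq j,\ ij\notin E(G)\rangle\subseteq k[x_1,\dots,x_n]$, and $\mathrm{reg}(G):=\max\{r : \beta_{i,i+r}(I(G))\neq 0 \text{ for some } i\}$ is its Castelnuovo-Mumford regularity, where $\beta_{i,j}$ are the graded Betti numbers. If $G$ is complete (so $I(G)=0$), $\mathrm{reg}(G)=1$ by convention. $G$ satisfies property $N_{2,p}$ if $I(G)$ is generated by quadrics and the first $p-1$ steps of its minimal free resolution are linear, i.e. $\beta_{i,j}(I(G))=0$ for all $0\le i\leq p-1$ and $j\neq i+2$. It is known (Eisenbud-Green-Hulek-Popescu) that for $p\geq 2$ this is equivalent to $G$ containing no hole (induced cycle of length at least four) of length at most $p+2$. *)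

(* Defs.v *)
From mathcomp Require Import all_boot all_order all_algebra.
(* mpoly has to be imported before mathcomp-analysis: in the other order their
   notations clash. *)
From mathcomp Require Import mpoly.
From mathcomp Require Import boolp classical_sets reals constructive_ereal.
From mathcomp Require Import ereal exp.

Set Implicit Arguments.
Unset Strict Implicit.
Unset Printing Implicit Defensive.

Import GRing.Theory.
Local Open Scope ring_scope.

Section Betti.
Variables (k : fieldType) (n : nat).

(* Minimal graded free resolution
     ... -> F_2 -> F_1 -> F_0 -> I -> 0
   of a homogeneous ideal I of S = k[x_0, ..., x_(n-1)], with
   F_i = \bigoplus_(a < res_rank i) S(- res_deg i a).  Elements of F_i are row
   vectors and maps act by right multiplication; res_aug : F_0 -> I and
   res_diff i : F_(i+1) -> F_i.  All maps have degree 0, so every monomial of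
   entry (a, b) has degree deg(a) - deg(b); the equations below avoid the
   truncated subtraction of nat.  Minimality is the condition
   im (F_(i+1) -> F_i) \subset (x_0, ..., x_(n-1)) F_i. *)
Record minimal_free_resolution (I : set {mpoly k[n]}) := MinimalFreeResolution {
  res_rank : nat -> nat;
  res_deg : forall i, 'I_(res_rank i) -> nat;
  res_aug : 'cV[{mpoly k[n]}]_(res_rank 0);
  res_diff : forall i, 'M[{mpoly k[n]}]_(res_rank i.+1, res_rank i);
  res_aug_graded : forall a, {in msupp (res_aug a 0),
    forall m : 'X_{1..n}, mdeg m = res_deg a};
  res_diff_graded : forall i a b, {in msupp (res_diff i a b),
    forall m : 'X_{1..n}, (mdeg m + res_deg b)%N = res_deg a};
  res_aug_onto : forall f,
    I f <-> exists u : 'rV_(res_rank 0), f = (u *m res_aug) 0 0;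
  res_exact0 : forall u : 'rV_(res_rank 0),
    u *m res_aug = 0 <-> exists v, u = v *m res_diff 0;
  res_exactS : forall i (u : 'rV_(res_rank i.+1)),
    u *m res_diff i = 0 <-> exists v, u = v *m res_diff i.+1;
  res_minimal : forall i a b, (res_diff i a b)@_0%MM = 0
}.

(* beta_(i,j)(I): the number of generators of degree j of the i-th module of a
   minimal graded free resolution.  Every homogeneous ideal has such a
   resolution, and the number does not depend on the resolution, so the set
   below is a singleton and the default value of xget is never used. *)
Definition betti (I : set {mpoly k[n]}) (i j : nat) : nat :=
  xget 0%N [set b | exists F : minimal_free_resolution I,
                      b = #|[set a | res_deg (m := F) (i := i) a == j]%SET| ].

Definition nonedge_ideal (G : rel 'I_n) : set {mpoly k[n]} :=
  [set f | exists c : 'I_n -> 'I_n -> {mpoly k[n]},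
     f = \sum_i \sum_(j | (i != j) && ~~ G i j) c i j * ('X_i * 'X_j)].

End Betti.

Arguments nonedge_ideal k {n} G.

Definition property_N2 (k : fieldType) (n : nat) (G : rel 'I_n) (p : nat) : Prop :=
  forall i j : nat, (i <= p - 1)%N -> j <> (i + 2)%N ->
    betti (nonedge_ideal k G) i j = 0%N.

Arguments property_N2 k {n} G p.

Definition complete_graph (n : nat) (G : rel 'I_n) : bool :=
  [forall i, forall j, (i != j) ==> G i j].

(* The supremum is a maximum (in particular finite) when G is not complete: the
   set is then nonempty, and it is finite by Hilbert's syzygy theorem.  Indices
   (i, j) with j < i can be ignored because beta_(i,j) vanishes there. *)
Definition regularity (R : realType) (k : fieldType) (n : nat) (G : rel 'I_n) :
    \bar R :=
  if complete_graph G then 1%:E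
  else ereal_sup [set r%:R%:E | r in
         [set r : nat | exists i, betti (nonedge_ideal k G) i (i + r)%N <> 0%N]].

Arguments regularity R k {n} G.

Definition logb (R : realType) (b x : R) : R := ln x / ln b.

(* Main.v *)
Require Import Defs.
(* mpoly redefines [symmetric]; importing it first keeps the meaning of ssrbool. *)
From mathcomp Require Import mpoly.
From mathcomp Require Import all_boot all_order all_algebra.
From mathcomp Require Import zify ring lra.
From mathcomp Require Import boolp.
From mathcomp Require Import reals constructive_ereal.
From mathcomp Require Import ereal exp.

(* Let Delta_W be the clique complex of G[W].  The fine grading of Koszul
   homology turns a generator of degree j of the i-th syzygy module into a class
   in the reduced cohomology of degree j - i - 2 of some Delta_W with |W| = j;
   conversely N_(2,p) forces H^1(Delta_W) = 0 whenever |W| <= p + 2, so G has no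
   short holes.  It remains to see that nonzero cohomology in degree d >= 2
   requires at least (p + 1) ((p + 4) / 2)^(d - 2) vertices.

   For a clique complex with cohomology in degree d and a vertex v, let h_d be a
   lower bound for the number of vertices outside the closed star of v, and
   alpha_d one for the size of an independent set among them.  In a minimal
   subcomplex carrying a class all links have cohomology in degree d - 1.  Take a
   vertex b and pairwise nonadjacent neighbours a of b: as G has no induced
   4-cycle, the sets N(a) \ N[b] are disjoint, and each has h_(d-1) elements.
   This yields h_d >= (1 + alpha_(d-1)) h_(d-1).  A shortest hole gives h_1 = p
   and alpha_1 = ceil(p / 2), and alpha_d can be taken to be ceil(p / 2) + 1 for
   d >= 2. *)

Set Implicit Arguments.
Unset Strict Implicit.
Unset Printing Implicit Defensive.

Import Order.TTheory GRing.Theory Num.Theory.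
Local Open Scope ring_scope.

(** * Cochains of clique complexes *)

(** The base of the logarithm dictates the recursion. With alpha_d = ceil(p / 2) in all degrees the
    growth factor would be only 1 + ceil(p / 2). One more independent vertex, gained in passing from
    degree 1 to degree 2 and kept afterwards, raises it to ceil(p / 2) + 2 >= (p + 4) / 2. For p >=
    3 induced pentagons are excluded too and alpha_1 can be squared; for p = 2 the square of 1 gains
    nothing, and the fact that a hole is not covered by two cliques is used instead.

    The vertex v in the definition of h_d is arbitrary, and a minimal set carrying a class may avoid
    it; hence the case distinction in [far_config].

    The resolution behind a vanishing Betti number in N_(2,p) may differ from the one behind the
    regularity. Koszul homology of the ideal mediates: [coh_of_generator] and [generator_of_coh2]
    hold for every minimal resolution. *)

Section Signs.
Variables (k : pzRingType) (n : nat).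
Implicit Types (s t : {set 'I_n}) (x y a : 'I_n).

Definition sg x s : k := (-1) ^+ #|[set y in s | (y < x)%N]|.

Lemma sgU1 x y s : y \notin s -> sg x (y |: s) = (-1) ^+ (y < x)%N * sg x s.
Proof.
move=> ys; rewrite /sg -exprD; congr (_ ^+ _).
have -> : [set z in y |: s | (z < x)%N] =
          (if (y < x)%N then [set y] else set0) :|: [set z in s | (z < x)%N].
  apply/setP=> z; rewrite !inE; case: (boolP (y < x)%N) => yx; rewrite !inE.
    by case: eqVneq => //= ->; rewrite yx.
  by case: eqVneq => //= ->; rewrite (negbTE yx) andbF.
case: ifP => yx; last by rewrite set0U.
by rewrite cardsU1 inE (negbTE ys).
Qed.

Lemma sgU x s : sg x (x |: s) = sg x s.
Proof.
congr (_ ^+ #|pred_of_set _|); apply/setP=> z; rewrite !inE.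
by case: eqVneq => //= ->; rewrite ltnn andbF.
Qed.

Lemma sgD x s : sg x (s :\ x) = sg x s.
Proof.
case: (boolP (x \in s)) => xs; first by rewrite -{2}(setD1K xs) sgU.
by congr sg; apply/setP=> z; rewrite !inE; case: eqVneq => // ->; rewrite (negbTE xs).
Qed.

Lemma sg_set1 x y : sg x [set y] = (-1) ^+ (y < x)%N.
Proof.
rewrite -[[set y]]setU0 sgU1 ?inE // /sg (_ : [set _ in _ | _] = set0) ?cards0 ?mulr1 //.
by apply/setP=> z; rewrite !inE.
Qed.

Lemma sg_sqr x s : sg x s * sg x s = 1.
Proof. by rewrite /sg -exprD addnn -mul2n exprM sqrrN !expr1n. Qed.

End Signs.
Arguments sg k {n} x s.

Section SignsCom.
Variables (k : comPzRingType) (n : nat).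
Implicit Types (s t : {set 'I_n}) (x y a : 'I_n).

(** The sign with which passing to the link of a, that is f to f (a |: s), anticommutes with the
    coboundary. *)
Lemma sg_swap (a x : 'I_n) s : a \notin s -> x \in s ->
  sg k x s * sg k a (s :\ x) = - (sg k a s * sg k x (a |: s)).
Proof.
move=> as_ xs; have ax : a != x by apply: contra as_ => /eqP ->.
have xt : x \notin s :\ x by rewrite !inE eqxx.
move: xt as_; rewrite -{2 3 5 6}(setD1K xs); move: (s :\ x) => t xt.
rewrite !inE negb_or => /andP[_ at_]; have xat : x \notin a |: t.
  by rewrite !inE negb_or eq_sym ax.
rewrite sgU setUCA sgU !sgU1 //.
by have [ax'|ax'] := boolP (a < x)%N; have [xa'|xa'] := boolP (x < a)%N;
  rewrite /= ?expr0 ?expr1; first [ring | move: ax; rewrite -val_eqE /=; lia].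
Qed.

Lemma sg_anti (x y : 'I_n) s : x \in s -> y \in s -> x != y ->
  sg k x s * sg k y (s :\ x) = - (sg k y s * sg k x (s :\ y)).
Proof.
move=> xs ys xy; rewrite -(sgD k y s) -(sgD k x s).
have {ys}ys : y \in s :\ x by rewrite !inE eq_sym xy.
pose t := s :\ x :\ y.
have xt : x \notin t by rewrite !inE eqxx andbF.
have yt : y \notin t by rewrite !inE eqxx.
have -> : s :\ x = y |: t by rewrite setD1K.
have -> : s :\ y = x |: t.
  apply/setP=> z; rewrite !inE; case: (eqVneq z x) => [->|//]; by rewrite xs xy.
rewrite !sgU !sgU1 //.
by have [ax'|ax'] := boolP (x < y)%N; have [xa'|xa'] := boolP (y < x)%N;
  rewrite /= ?expr0 ?expr1; first [ring | move: xy; rewrite -val_eqE /=; lia].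
Qed.

Lemma sg_antiU (x y : 'I_n) s : x \notin s -> y \notin s -> x != y ->
  sg k x (y |: s) * sg k y s = - (sg k y (x |: s) * sg k x s).
Proof.
move=> xs ys xy; rewrite !sgU1 //.
by have [ax'|ax'] := boolP (x < y)%N; have [xa'|xa'] := boolP (y < x)%N;
  rewrite /= ?expr0 ?expr1; first [ring | move: xy; rewrite -val_eqE /=; lia].
Qed.

Lemma sg_compl (x : 'I_n) s t : s \subset t -> sg k x s = sg k x t * sg k x (t :\: s).
Proof.
move=> st; rewrite [sg k x t](_ : _ = sg k x s * sg k x (t :\: s)).
  by rewrite -mulrA sg_sqr mulr1.
rewrite /sg -exprD; congr (_ ^+ _).
set P := fun u : {set 'I_n} => [set y in u | (y < x)%N].
have -> : [set y in t | (y < x)%N] = P s :|: P (t :\: s).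
  apply/setP=> z; rewrite !inE; case: (boolP (z \in s)) => zs //=.
  by rewrite (subsetP st) //= orbF.
rewrite cardsU (_ : P s :&: P _ = set0) ?cards0 ?subn0 //.
by apply/setP=> z; rewrite !inE; case: (z \in s); rewrite ?andbF.
Qed.
End SignsCom.

(** The terms (x, y) and (y, x) are paired along the order of the indices; concluding from S = - S
    would fail in the presence of 2-torsion. *)
Lemma sum_antisym (V : zmodType) (n : nat) (P : pred 'I_n) (F : 'I_n -> 'I_n -> V) :
  (forall x y, P x -> P y -> x != y -> F x y = - F y x) ->
  \sum_(x | P x) \sum_(y | P y && (y != x)) F x y = 0.
Proof.
move=> FN; pose S := \sum_(x | P x) \sum_(y | P y && (y < x)%N) F x y.
have -> : \sum_(x | P x) \sum_(y | P y && (y != x)) F x y =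
          S + \sum_(x | P x) \sum_(y | P y && (x < y)%N) F x y.
  rewrite -big_split /=; apply: eq_bigr => x Px.
  rewrite (bigID (fun y : 'I_n => (y < x)%N)) /=.
  by congr (_ + _); apply: eq_bigl => y; rewrite -val_eqE /=; lia.
rewrite [X in _ + X](exchange_big_dep P) /=; last by move=> ? ? _ /andP[].
apply/eqP; rewrite addr_eq0 -sumrN; apply/eqP; apply: eq_bigr => x Px.
rewrite -sumrN; apply: eq_big => [y|y /andP[Py yx]]; first by rewrite Px.
by rewrite FN // -val_eqE /=; lia.
Qed.

Section Cohomology.
Variables (k : fieldType) (n : nat) (G : rel 'I_n).
Hypotheses (G_sym : symmetric G) (G_irr : irreflexive G).
Implicit Types (A B D s t : {set 'I_n}) (f g : {set 'I_n} -> k) (e : nat).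

Definition clique s := [forall x in s, forall y in s, (x != y) ==> G x y].

Lemma cliqueP s : reflect {in s &, forall x y, x != y -> G x y} (clique s).
Proof.
apply: (iffP 'forall_in_'forall_in_implyP) => H x y; first by move=> *; apply: H.
by move=> xs yx; apply: H.
Qed.

Lemma sub_clique s t : s \subset t -> clique t -> clique s.
Proof.
move=> st /cliqueP H; apply/cliqueP => x y xs ys.
by apply: H; apply: (subsetP st).
Qed.

Definition nbhd a := [set y | G a y].

Lemma cliqueU1 a s : clique s -> s \subset nbhd a -> clique (a |: s).
Proof.
move=> /cliqueP cs /subsetP sa; apply/cliqueP => x y.
rewrite !inE => /predU1P[->|xs] /predU1P[->|ys]; rewrite ?eqxx //.
- by move=> _; have := sa _ ys; rewrite inE.
- by move=> _; have := sa _ xs; rewrite inE G_sym.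
- exact: cs.
Qed.

Lemma cliqueU1_nbhd a s : a \notin s -> clique (a |: s) -> s \subset nbhd a.
Proof.
move=> as_ /cliqueP H; apply/subsetP => x xs; rewrite inE; apply: H.
- by rewrite setU11.
- by rewrite inE xs orbT.
- by apply: contraNneq as_ => ->.
Qed.

Lemma setU1D1 a x s : a \notin s -> x \in s -> (a |: s) :\ x = a |: (s :\ x).
Proof.
move=> as_ xs; apply/setP=> z; rewrite !inE; case: (eqVneq z x) => //= ->.
by rewrite orbF; apply/esym/negbTE; apply: contraNneq as_ => <-.
Qed.

(* Cochains are functions on all vertex sets; only their values on cliques of the
   relevant cardinality matter. *)
Definition cobd f t := \sum_(x in t) sg k x t * f (t :\ x).

(* The restriction map from the reduced cohomology of the clique complex of D to
   that of A is nonzero in degree e - 1: the index e counts vertices. *)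
Definition coh e A D := exists2 f,
  forall t, t \subset D -> clique t -> #|t| = e.+1 -> cobd f t = 0 &
  ~ exists g, forall t, t \subset A -> clique t -> #|t| = e -> f t = cobd g t.

Lemma cohS e A A' D D' : A \subset A' -> D' \subset D ->
  coh e A D -> coh e A' D'.
Proof.
move=> AA DD [f fc fn]; exists f => [t tD|[g gf]].
  exact: fc (subset_trans tD DD).
by apply: fn; exists g => t tA; apply: gf (subset_trans tA AA).
Qed.

Lemma cobdB f g t : cobd (fun s => f s - g s) t = cobd f t - cobd g t.
Proof. by rewrite /cobd -sumrB; apply: eq_bigr => x _; rewrite mulrBr. Qed.

Lemma cobdD f g t : cobd (fun s => f s + g s) t = cobd f t + cobd g t.
Proof. by rewrite /cobd -big_split; apply: eq_bigr => x _; rewrite mulrDr. Qed.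

Lemma cobd_cobd f t : cobd (cobd f) t = 0.
Proof.
rewrite /cobd; under eq_bigr do rewrite big_distrr /=.
pose F (x y : 'I_n) := sg k x t * (sg k y (t :\ x) * f (t :\ x :\ y)).
rewrite (eq_bigr (fun x => \sum_(y | (y \in t) && (y != x)) F x y)); last first.
  by move=> x xt; apply: eq_bigl => y; rewrite !inE andbC.
apply: sum_antisym => x y xt yt xy; rewrite /F !mulrA -mulNr !setDDl [[set x] :|: _]setUC.
by congr (_ * _); apply: sg_anti.
Qed.

(* A cocycle of D that becomes trivial on B minus a can be normalized to vanish on
   the cliques of B avoiding a; it is then the join of a with a cocycle of the link
   of a. *)
Lemma coh_link e A B D a : A \subset B -> B \subset D -> a \in A ->
  coh e.+1 A D -> ~ coh e.+1 (B :\ a) D -> coh e (A :&: nbhd a) (B :&: nbhd a).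
Proof.
move=> AB BD aA [f fc fn] nB.
have aB : a \in B by apply: (subsetP AB).
have [g0 fg0] : exists g, forall t, t \subset B :\ a -> clique t -> #|t| = e.+1 -> f t = cobd g t.
  by apply: contrapT => H; apply: nB; exists f.
pose g s := if a \in s then 0 else g0 s.
pose f' s := f s - cobd g s.
have f'0 s : s \subset B -> a \notin s -> clique s -> #|s| = e.+1 -> f' s = 0.
  move=> sB as_ cs se; apply/eqP; rewrite subr_eq0 fg0 //; last by rewrite subsetD1 sB.
  by apply/eqP/eq_bigr => x _; rewrite /g !inE (negbTE as_) andbF.
have nba s : s \subset nbhd a -> a \notin s.
  by move=> /subsetP sa; apply: contraT => /negPn /sa; rewrite inE G_irr.
exists (fun s => sg k a s * f' (a |: s)) => [s|[h hP]].
  rewrite subsetI => /andP[sB sa] cs se.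
  have as_ := nba _ sa.
  have : cobd f' (a |: s) = 0.
    rewrite cobdB cobd_cobd subr0 fc ?cliqueU1 ?cardsU1 ?as_ ?se //.
    by apply: subset_trans BD; rewrite subUset sub1set aB.
  rewrite /cobd big_setU1 //= setU1K // f'0 // mulr0 add0r => H.
  rewrite (eq_bigr (fun x => - sg k a s * (sg k x (a |: s) * f' ((a |: s) :\ x)))).
    by rewrite -big_distrr /= H mulr0.
  move=> x xs; rewrite mulrA sg_swap // -!mulNr -mulrA.
  by rewrite setU1D1.
(* [h'] is the join of a with the assumed primitive [h] on the link. Its coboundary is [f'] on the
   cliques of A containing a, and both vanish on the others; so [h' + g] would be a primitive of f
   on A. *)
pose h' s := if a \in s then - sg k a s * h (s :\ a) else 0.
apply: fn; exists (fun s => h' s + g s) => t tA ct te; rewrite cobdD.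
apply/eqP; rewrite -subr_eq; apply/eqP; rewrite -/(f' t).
have [at_|at_] := boolP (a \in t); last first.
  rewrite f'0 //; last exact: subset_trans AB.
  by rewrite /cobd big1 // => x _; rewrite /h' !inE (negbTE at_) andbF mulr0.
have [s as_ ts] : exists2 s : {set 'I_n}, a \notin s & t = a |: s.
  by exists (t :\ a); rewrite ?setD1K // !inE eqxx.
have st : s \subset t by rewrite ts subsetUr.
have cs : clique s by apply: sub_clique ct.
have sa : s \subset nbhd a by apply: cliqueU1_nbhd => //; rewrite -ts.
have := hP s; rewrite subsetI sa andbT => /(_ _ cs) => H.
apply: (mulrI (x := sg k a s)).
  by apply/unitrPr; exists (sg k a s); rewrite sg_sqr.
rewrite {1}ts H; first last.
- by move: te; rewrite ts cardsU1 as_; case.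
- exact: subset_trans tA.
rewrite ts [RHS]mulrC /cobd big_setU1 //= setU1K // {1}/h' (negbTE as_) mulr0 add0r.
rewrite big_distrl; apply: eq_bigr => x xs /=.
rewrite setU1D1 // /h' setU11 sgU setU1K; last by rewrite !inE (negbTE as_) andbF.
have e1 := sg_swap k as_ xs.
have -> : sg k x s = sg k x s * (sg k a (s :\ x) * sg k a (s :\ x)) by rewrite sg_sqr mulr1.
rewrite mulrA e1; ring.
Qed.

End Cohomology.

Lemma sum_card_disjoint (T : finType) (I : {set T}) (F : T -> {set T}) (Z : {set T}) :
  (forall a, a \in I -> F a \subset Z) ->
  (forall a b x, a \in I -> b \in I -> x \in F a -> x \in F b -> a = b) ->
  (\sum_(a in I) #|F a| <= #|Z|)%N.
Proof.
move=> FZ Fd.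
rewrite (eq_bigr (fun a => \sum_(x in Z | x \in F a) 1)%N); last first.
  move=> a /FZ aZ; rewrite -sum1_card; apply: eq_bigl => x.
  by apply/esym/andb_idl/(subsetP aZ).
rewrite (exchange_big_dep (mem Z)) /=; last by move=> a x _ /andP[].
rewrite -[leqRHS]sum1_card; apply: leq_sum => x xZ; rewrite sum1_card.
by apply/card_le1_eqP => a b /andP[aI /andP[_ xa]] /andP[bI /andP[_ xb]]; apply: Fd xb xa.
Qed.

(** * Vertices far from a given vertex *)

Section Structure.
Variables (k : fieldType) (n : nat) (G : rel 'I_n).
Hypotheses (G_sym : symmetric G) (G_irr : irreflexive G).
Implicit Types (A B D I J X : {set 'I_n}) (v a b c : 'I_n) (e : nat).

Notation nbhd := (nbhd G).
Notation coh := (coh k G).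

Lemma coh_neq0 e A D : coh e.+1 A D -> A != set0.
Proof.
move=> [f _ fn]; apply: contra_not_neq fn => ->.
exists f => t; rewrite subset0 => /eqP ->; by rewrite cards0.
Qed.

(* A is chosen to minimize 2 |A| + [v notin A]: exchanging a vertex for v is then an
   improvement, which gives the statement about v |: A. *)
Lemma coh_minimal e D v : v \in D -> coh e.+1 D D -> exists A,
  [/\ A \subset D, coh e.+1 A D & forall a, a \in A ->
      coh e (A :&: nbhd a) (A :&: nbhd a) /\
      coh e ((v |: A) :&: nbhd a) ((v |: A) :&: nbhd a)].
Proof.
move=> vD HD; pose P A := `[< A \subset D /\ coh e.+1 A D >].
pose mu A := (2 * #|A| + (v \notin A))%N.
have PD : P D by apply/asboolP.
case: (arg_minnP mu PD) => A /asboolP[AD HA] Amin; exists A; split=> // a aA.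
have link : coh e (A :&: nbhd a) ((v |: A) :&: nbhd a).
  have vAD : v |: A \subset D by rewrite subUset sub1set vD.
  apply: (coh_link G_sym G_irr (subsetUr _ _) vAD aA HA) => HB.
  have /Amin : P ((v |: A) :\ a).
    by apply/asboolP; split; rewrite // subDset subsetU // vAD orbT.
  rewrite /mu; have := cardsD1 a (v |: A); rewrite cardsU1 !inE aA orbT eqxx /=.
  case: (eqVneq v a) => [->|_]; rewrite ?aA /=; case: (v \in A) => /=; do ?[move: #|_|]; clear; lia.
by split; apply: (cohS _ _ link); rewrite // setSI // subsetUr.
Qed.

Definition indep I := [forall x in I, forall y in I, ~~ G x y].

Lemma indepP I : reflect {in I &, forall x y, ~~ G x y} (indep I).
Proof.
apply: (iffP 'forall_in_'forall_in_idP) => H x; first by move=> y xI; apply: H.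
by move=> xI y; apply: H.
Qed.

Definition far A v := A :\: (v |: nbhd v).

Lemma in_far A v x : (x \in far A v) = [&& x \in A, x != v & ~~ G v x].
Proof. by rewrite !inE negb_or -andbA [RHS]andbC andbA. Qed.

(** The bounds h_d and alpha_d of the overview, with d = e - 1. Links are again of the form
    [D :&: nbhd a], so quantifying over all D makes the bounds available there. *)
Definition far_bound e h al := forall D v, v \in D -> coh e D D ->
  (h <= #|far D v|)%N /\ exists2 I : {set 'I_n}, I \subset far D v & indep I && (al <= #|I|)%N.

Definition square_free := forall a b c d, G a b -> G b c -> G c d -> G d a ->
  a != c -> b != d -> G a c || G b d.

Hypothesis G_sqf : square_free.

(* Either X is empty and I has 1 + al elements, or v has a neighbour b in A, I has
   only al elements, and X, the vertices adjacent to b and far from v, makes up for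
   the missing one. *)
Definition far_data e h al D v := exists (A : {set 'I_n}) (b : 'I_n) (I X : {set 'I_n}),
  [/\ A \subset D /\ (forall a, a \in A -> coh e.+1 (A :&: nbhd a) (A :&: nbhd a)),
      indep I /\ I \subset A :&: nbhd b,
      b \in A /\ forall a, a \in I -> far (A :&: nbhd a) b \subset far D v,
      X \subset far D v :&: nbhd b &
      (al <= #|I|) /\ ((1 + al) * h <= #|I| * h + #|X|)]%N.

(** The vertex b has to be such that what is far from b in the links of A is far from v in D. If v
    lies in A, b = v will do, and if v has no neighbour in A, any b in A. Otherwise b is a neighbour
    of v, and the bounds for v in the link of b taken in v |: A supply [X] and [I]. *)
Lemma far_config e h al : far_bound e.+1 h al -> forall D v, v \in D -> coh e.+2 D D ->
  far_data e h al D v.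
Proof.
move=> Qe D v vD HD; have [A [AD HA HAa]] := coh_minimal vD HD.
have HAa1 a : a \in A -> coh e.+1 (A :&: nbhd a) (A :&: nbhd a) by move=> /HAa[].
have case1 b : b \in A -> far A b \subset far D v -> far_data e h al D v.
  move=> bA bv; have Hb := HAa1 b bA.
  have /set0Pn[w wb] := coh_neq0 Hb.
  have [_ [I Iw /andP[/indepP iI cI]]] := Qe _ _ wb Hb.
  have wI x : x \in I -> [&& x \in A :&: nbhd b, x != w & ~~ G w x].
    by move=> xI; rewrite -in_far (subsetP Iw).
  have wI' : w \notin I by apply/negP => /wI; rewrite eqxx andbF.
  (* All elements of [I] are far from w, so w can be added and [X] may be empty. *)
  exists A, b, (w |: I), set0; split=> //.
  - split; last by rewrite subUset sub1set wb (subset_trans Iw) // subsetDl.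
    apply/indepP => x y; rewrite !inE => /predU1P[->|xI] /predU1P[->|yI].
    + by rewrite G_irr.
    + by case/and3P: (wI _ yI).
    + by rewrite G_sym; case/and3P: (wI _ xI).
    + exact: iI.
  - split=> // a aI; apply: subset_trans bv; apply: setSD; exact: subsetIl.
  - exact: sub0set.
  - rewrite cardsU1 wI' cards0 addn0; split; first by lia.
    by rewrite leq_mul2r; apply/orP; right; lia.
have [vA|vA] := boolP (v \in A); first by apply: (case1 v) => //; apply: setSD.
have [A0|[b]] := set_0Vmem (A :&: nbhd v).
  have /set0Pn[b bA] := coh_neq0 HA; apply: (case1 b) => //.
  apply/subsetP => x; rewrite !in_far => /and3P[xA _ _]; rewrite (subsetP AD) //=.
  have := in_set0 x; rewrite -A0 !inE xA /= => ->.
  by rewrite andbT; apply: contraNneq vA => <-.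
rewrite inE => /andP[bA]; rewrite inE => vb.
have vZ : v \in (v |: A) :&: nbhd b by rewrite !inE eqxx G_sym.
have [hX [I IX /andP[iI cI]]] := Qe _ _ vZ (HAa b bA).2.
set X := far _ v in hX IX.
have inX x : x \in X -> [/\ x \in A, G b x, x != v & ~~ G v x].
  rewrite in_far !inE => /and3P[/andP[+ bx] xv vx]; by rewrite (negbTE xv).
exists A, b, I, X; split=> //.
- split=> //; apply/subsetP => x xI; have [] := inX x ((subsetP IX) _ xI).
  by rewrite !inE => -> ->.
- split=> // a aI; have [aA ba av va] := inX _ ((subsetP IX) _ aI).
  apply/subsetP => y; rewrite !in_far !inE => /and3P[/andP[yA ay] yb bY].
  rewrite (subsetP AD) //=; have -> /= : y != v by apply: contraNneq vA => <-.
  (* A neighbour y of v would close an induced 4-cycle v, b, a, y. *)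
  apply/negP => vy; have := @G_sqf v b a y vb ba ay.
  rewrite G_sym vy eq_sym av (negbTE va) (negbTE bY) eq_sym yb.
  by move=> /(_ isT isT isT).
- apply/subsetP => x /inX[xA bx xv vx]; rewrite in_setI in_far inE bx xv vx.
  by rewrite (subsetP AD).
- split=> //; move: cI hX; rewrite mulnDl mul1n addnC => cI hX.
  by apply: leq_add => //; rewrite leq_mul2r cI orbT.
Qed.

(** A common element x would make b, a, x, a' an induced 4-cycle. *)
Lemma far_disjoint A b a a' x : G b a -> G b a' -> a != a' -> ~~ G a a' ->
  x \in far (A :&: nbhd a) b -> x \notin far (A :&: nbhd a') b.
Proof.
move=> ba ba' aa' naa'; rewrite !in_far !inE => /and3P[/andP[xA ax] xb bx].
rewrite xb bx xA /= andbT; apply/negP => a'x.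
have := @G_sqf b a x a' ba ax; rewrite [G x a']G_sym a'x G_sym ba' eq_sym xb aa'.
by rewrite (negbTE bx) (negbTE naa') => /(_ isT isT isT isT).
Qed.

Definition has_indep D al := exists2 I : {set 'I_n}, I \subset D & indep I && (al <= #|I|)%N.

(** Each a in [I] contributes the vertices far from b in its link, at least h of them. These sets
    are disjoint, and they miss [X] because [X] lies in the neighbourhood of b. *)
Lemma far_step e h al al' :
  far_bound e.+1 h al ->
  (forall D v, v \in D -> coh e.+2 D D -> has_indep (far D v) al') ->
  far_bound e.+2 ((1 + al) * h) al'.
Proof.
move=> Qe Ha D v vD HD; split; last exact: Ha.
have [A [b [I [X [[AD HAa] [/indepP iI Ib] [bA If] Xf [_ cI]]]]]] := far_config Qe vD HD.
have IP a : a \in I -> a \in A /\ G b a.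
  by move=> aI; have := (subsetP Ib) _ aI; rewrite !inE => /andP.
apply: leq_trans cI _.
have XD : X \subset far D v by apply: subset_trans Xf (subsetIl _ _).
have -> : #|far D v| = (#|far D v :\: X| + #|X|)%N.
  by rewrite cardsDS // subnK // subset_leq_card.
rewrite leq_add2r.
apply: leq_trans (sum_card_disjoint (I := I) (F := fun a => far (A :&: nbhd a) b) _ _).
- rewrite -sum_nat_const; apply: leq_sum => a aI; have [aA ba] := IP a aI.
  have bN : b \in A :&: nbhd a by rewrite !inE bA G_sym.
  by have [] := Qe _ _ bN (HAa a aA).
- move=> a aI; rewrite subsetD If //=; rewrite disjoint_subset; apply/subsetP => x.
  rewrite in_far => /and3P[_ _ bx]; rewrite inE; apply: contra bx => /(subsetP Xf).
  by rewrite !inE => /andP[].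
- move=> a a' x aI a'I xa; apply: contraTeq => aa'.
  by apply: far_disjoint xa => //; [apply: (IP a _).2|apply: (IP a' _).2|apply: iI].
Qed.

(** An independent set far from b in the link of a single a in [I] is already far from v. *)
Lemma far_indep_mono e h al D v : (0 < al)%N -> far_bound e.+1 h al ->
  v \in D -> coh e.+2 D D -> has_indep (far D v) al.
Proof.
move=> al0 Qe vD HD.
have [A [b [I [X [[AD HAa] [iI Ib] [bA If] _ [aI _]]]]]] := far_config Qe vD HD.
have /set0Pn[a aI'] : I != set0 by rewrite -card_gt0; apply: leq_trans aI.
have := (subsetP Ib) _ aI'; rewrite !inE => /andP[aA ba].
have bN : b \in A :&: nbhd a by rewrite !inE bA G_sym.
have [_ [J Jf HJ]] := Qe _ _ bN (HAa a aA).
by exists J => //; apply: subset_trans Jf (If _ _).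
Qed.

Definition pentagon_free := forall a b c d (e : 'I_n),
  G a b -> G b c -> G c d -> G d e -> G e a ->
  [|| G a c, G b d, G c e, G d a | G e b].

(** The independent sets [J a], far from b in the links of the a in [I], are joined together. An
    edge between x in [J a] and y in [J a'] would close a chordless 5-cycle b, a, x, y, a'. *)
Lemma far_indep_sq e h al D v : pentagon_free -> far_bound e.+1 h al ->
  v \in D -> coh e.+2 D D -> has_indep (far D v) (al * al).
Proof.
move=> G_pf Qe vD HD.
have [A [b [I [X [[AD HAa] [/indepP iI Ib] [bA If] _ [aI _]]]]]] := far_config Qe vD HD.
have IP a : a \in I -> a \in A /\ G b a.
  by move=> a_I; have := (subsetP Ib) _ a_I; rewrite !inE => /andP.
have /choice[J JP] a : exists J, a \in I ->
    J \subset far (A :&: nbhd a) b /\ indep J && (al <= #|J|)%N.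
  have [aI'|//] := boolP (a \in I); last by exists set0.
  have [aA ba] := IP a aI'.
  have bN : b \in A :&: nbhd a by rewrite !inE bA G_sym.
  by have [_ [J Jf HJ]] := Qe _ _ bN (HAa a aA); exists J.
have Jdis a a' x : a \in I -> a' \in I -> a != a' -> x \in J a ->
    x \notin far (A :&: nbhd a') b.
  move=> a_I a'I aa' /(subsetP (JP a a_I).1).
  by apply: far_disjoint aa' _; [apply: (IP a _).2|apply: (IP a' _).2|apply: iI].
exists (\bigcup_(a in I) J a).
  apply/bigcupsP => a a_I; exact: subset_trans (JP a a_I).1 (If a a_I).
apply/andP; split; last first.
  apply: leq_trans (sum_card_disjoint (I := I) (F := J) _ _).
  - apply: (@leq_trans (#|I| * al)); first by rewrite leq_mul2r aI orbT.
    rewrite -sum_nat_const; apply: leq_sum => a a_I.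
    by have [_ /andP[]] := JP a a_I.
  - by move=> a a_I; apply: bigcup_sup.
  - move=> a a' x a_I a'I xa xa'; apply: contraTeq xa' => aa'.
    apply: contra (Jdis _ _ _ a_I a'I aa' xa) => xa'.
    by apply: (subsetP (JP a' a'I).1).
apply/indepP => x y /bigcupP[a a_I xa] /bigcupP[a' a'I ya'].
have [aa'|aa'] := eqVneq a a'.
  by rewrite aa' in xa; have [_ /andP[/indepP iJ _]] := JP a' a'I; apply: iJ.
have xf := (subsetP (JP a a_I).1) _ xa; have yf := (subsetP (JP a' a'I).1) _ ya'.
have xn := Jdis _ _ _ a_I a'I aa' xa.
have yn : y \notin far (A :&: nbhd a) b by apply: (Jdis a' a) => //; rewrite eq_sym.
move: xn yn; rewrite !in_far !inE in xf yf *.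
have [xA ax xb bx] : [/\ x \in A, G a x, x != b & ~~ G b x].
  by case/and3P: xf => /andP[].
have [yA ay yb by_] : [/\ y \in A, G a' y, y != b & ~~ G b y].
  by case/and3P: yf => /andP[].
rewrite xA yA xb yb bx by_ /= !andbT => xn yn.
apply/negP => xy.
have [_ ba] := IP a a_I; have [_ ba'] := IP a' a'I.
have := G_pf b a x y a' ba ax xy; rewrite G_sym ay G_sym ba' => /(_ isT isT).
rewrite (negbTE bx) (negbTE yn) G_sym (negbTE xn) G_sym (negbTE by_).
by rewrite G_sym (negbTE (iI _ _ a_I a'I)).
Qed.

(* If the vertices far from v formed a clique, the neighbourhood of one of them
   would be covered by this clique and its common neighbours with v. *)
Lemma far_indep2 e h al D v : (0 < h)%N -> (0 < al)%N -> far_bound e.+1 h al ->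
  (forall D K L : {set 'I_n}, coh e.+1 D D -> clique G K -> clique G L -> ~~ (D \subset K :|: L)) ->
  v \in D -> coh e.+2 D D -> has_indep (far D v) 2.
Proof.
move=> h0 al0 Qe Hcl vD HD.
have [A [b [I [X [[AD HAa] [_ Ib] [bA If] _ [aI _]]]]]] := far_config Qe vD HD.
have /set0Pn[a aI'] : I != set0 by rewrite -card_gt0; apply: leq_trans aI.
have := (subsetP Ib) _ aI'; rewrite !inE => /andP[aA ba].
have bN : b \in A :&: nbhd a by rewrite !inE bA G_sym.
have [hf _] := Qe _ _ bN (HAa a aA).
have /set0Pn[c cf] : far (A :&: nbhd a) b != set0.
  by rewrite -card_gt0; apply: leq_trans hf.
have cA : c \in A by move: cf; rewrite in_far !inE => /andP[/andP[]].
have {cf} : c \in far D v by apply: subsetP cf; apply: If.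
rewrite in_far => /and3P[_ cv vc].
have cnv : clique G (nbhd v :&: nbhd c).
  apply/cliqueP => x y; rewrite !inE => /andP[vx cx] /andP[vy cy] xy.
  have := G_sqf vx _ cy; rewrite [G x c]G_sym cx G_sym vy => /(_ isT isT).
  by rewrite eq_sym cv xy (negbTE vc) => /(_ isT isT).
have [cf|] := boolP (clique G (far D v)).
  have /negP[] := Hcl _ _ _ (HAa c cA) cnv cf.
  apply/subsetP => x; rewrite in_setU in_far !inE => /andP[xA cx].
  rewrite cx (subsetP AD) //= andbT; case: (boolP (G v x)) => //= _.
  by rewrite andbT; apply: contraNneq vc => <-; rewrite G_sym.
rewrite negb_forall_in => /existsP[x /andP[xf]].
rewrite negb_forall_in => /existsP[y /andP[yf]]; rewrite negb_imply => /andP[xy nxy].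
exists [set x; y]; first by rewrite subUset !sub1set xf.
rewrite cards2 xy andbT; apply/indepP => z t; rewrite !inE.
by case/orP=> /eqP-> /orP[]/eqP->; rewrite ?G_irr // G_sym.
Qed.

End Structure.

(** * Holes and cohomology in degree one *)

Section Potential.
Variables (k : zmodType) (T : finType) (r : rel T) (w : T -> T -> k).
Hypothesis r_sym : symmetric r.

Fixpoint weight x s := if s is y :: s' then w x y + weight y s' else 0.

Lemma weight_cat x s1 s2 : weight x (s1 ++ s2) = weight x s1 + weight (last x s1) s2.
Proof. by elim: s1 x => [|y s1 IH] x /=; rewrite ?add0r // IH addrA. Qed.

(** [g] integrates w along a chosen path from the root of the component. The path to y and the path
    to x prolonged by the edge xy are compared by closing both with the same way back [Q y]. *)
Lemma potential :
  (forall x s, path r x s -> last x s = x -> weight x s = 0) ->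
  exists g, forall x y, r x y -> w x y = g y - g x.
Proof.
move=> W0.
have rt x : connect r (fingraph.root r x) x.
  by rewrite sym_connect_sym ?connect_root.
have /choice[P PP] x : exists s, path r (fingraph.root r x) s /\ last (fingraph.root r x) s = x.
  by have /connectP[s] := rt x; exists s.
have /choice[Q QP] x : exists s, path r x s /\ last x s = fingraph.root r x.
  by have /connectP[s] := connect_root r x; exists s.
exists (fun x => weight (fingraph.root r x) (P x)) => x y xy.
have [[pP lP] [pQ lQ]] := (PP x, QP y); have [pPy lPy] := PP y.
have rxy : fingraph.root r x = fingraph.root r y.
  by apply/(fingraph.rootP (sym_connect_sym r_sym))/connect1.
have := W0 (fingraph.root r y) (P y ++ Q y); rewrite cat_path last_cat weight_cat pPy lPy pQ lQ.
move=> /(_ isT erefl) e1.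
have := W0 (fingraph.root r x) (P x ++ y :: Q y).
rewrite cat_path last_cat weight_cat pP lP /= xy pQ lQ.
move=> /(_ isT (esym rxy)) e2.
move/eqP: e1; rewrite addr_eq0 => /eqP ->; move/eqP: e2; rewrite addrA addr_eq0 => /eqP <-.
by rewrite [X in X - _]addrC addrK.
Qed.

Definition closed_walk (f : nat -> T) m := f m = f 0%N /\ forall t, (t < m)%N -> r (f t) (f t.+1).

Definition fweight (f : nat -> T) m := \sum_(t < m) w (f t) (f t.+1).

Lemma closed_walk_of_path x s : path r x s -> last x s = x ->
  exists f m, closed_walk f m /\ fweight f m = weight x s.
Proof.
move=> ps ls; exists (nth x (x :: s)), (size s); split.
  split=> [|t ts]; first by rewrite /= -[in RHS]ls -nth_last /=; case: (s).
  exact: (pathP x ps).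
rewrite /fweight /= => {ps ls}.
suff H y : \sum_(t < size s) w (nth x (y :: s) t) (nth x s t) = weight y s by exact: H.
elim: s y => [|z s IH] y /=; first by rewrite big_ord0.
by rewrite big_ord_recl /= -IH.
Qed.
End Potential.

Section MinimalWalk.
Variables (k : zmodType) (T : finType) (r : rel T) (w : T -> T -> k).
Hypotheses (r_sym : symmetric r) (r_irr : irreflexive r).
Hypothesis w_anti : forall x y, r x y -> w y x = - w x y.
Hypothesis w_tri : forall x y z, r x y -> r y z -> r z x -> w x y + w y z + w z x = 0.

Notation closed_walk := (closed_walk r).
Notation fweight := (fweight w).

(** A shortest walk of nonzero weight, continued periodically so that arcs can start at any index
    and wrap around. *)
Lemma minimal_walk f m : closed_walk f m -> fweight f m != 0 -> exists c L,
  [/\ forall i, c (i + L)%N = c i, forall i, r (c i) (c i.+1), fweight c L != 0 &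
      forall f m, (m < L)%N -> closed_walk f m -> fweight f m = 0].
Proof.
move=> fm wm; pose P m := `[< exists2 f, closed_walk f m & fweight f m != 0 >].
have exP : exists m, P m by exists m; apply/asboolP; exists f.
case: (ex_minnP exP) => L /asboolP[g [gL gr] gw] Lmin.
have L0 : (0 < L)%N by case: (L) gw => //; rewrite /fweight big_ord0 eqxx.
exists (fun i => g (i %% L)%N), L; split.
- by move=> i; rewrite modnDr.
- move=> i; have iL := ltn_pmod i L0; have := gr _ iL.
  have -> : (i.+1 %% L = (i %% L).+1 %% L)%N by rewrite -addn1 -modnDml addn1.
  have [->|/eqP ne] := eqVneq (i %% L).+1 L; first by rewrite modnn gL.
  by rewrite [((i %% L).+1 %% L)%N]modn_small //; move: ne iL; lia.
- rewrite /fweight; rewrite (eq_bigr (fun t : 'I_L => w (g t) (g t.+1))) // => t _.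
  rewrite modn_small //; have [->|/eqP ne] := eqVneq t.+1 L; first by rewrite modnn gL.
  by rewrite modn_small //; have := ltn_ord t; lia.
- move=> h m' m'L hc; apply: contraPP m'L => /eqP hw; apply/negP; rewrite -leqNgt.
  by apply: Lmin; apply/asboolP; exists h.
Qed.

Variables (c : nat -> T) (L : nat).
Hypothesis c_per : forall i, c (i + L)%N = c i.
Hypothesis c_r : forall i, r (c i) (c i.+1).
Hypothesis c_w : fweight c L != 0.
Hypothesis c_min : forall f m, (m < L)%N -> closed_walk f m -> fweight f m = 0.

Let W i m := \sum_(t < m) w (c (i + t)) (c (i + t).+1).

Let WD i m1 m2 : W i (m1 + m2) = W i m1 + W (i + m1) m2.
Proof.
rewrite /W big_split_ord /=; congr (_ + _).
by apply: eq_bigr => t _; rewrite addnA.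
Qed.

Let WL i : W i L != 0.
Proof.
have e : W i L = fweight c L.
  elim: i => [|i <-]; first by [].
  have : W i (1 + L) = W i (L + 1) by rewrite addnC.
  have W1 : W (i + L) 1 = W i 1.
    by rewrite /W !big_ord1 !addn0 -addSn !c_per.
  by rewrite !WD W1 [RHS]addrC addn1 => /addrI ->.
by rewrite e.
Qed.

Let W_closed i m : (m < L)%N -> c (i + m)%N = c i -> W i m = 0.
Proof.
move=> mL e; rewrite -[RHS](c_min (f := fun t => c (i + t)%N) mL).
  by apply: eq_bigr => t _; rewrite addnS.
by split=> [|t _]; rewrite ?addn0 // addnS.
Qed.

Let W_edge i m : (m.+1 < L)%N -> r (c (i + m)) (c i) -> W i m + w (c (i + m)) (c i) = 0.
Proof.
move=> mL e; pose f t := if (t <= m)%N then c (i + t)%N else c i.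
have fm : closed_walk f m.+1.
  split; first by rewrite /f ltnn addn0.
  rewrite /f => t tm; rewrite -ltnS tm; case: ltnP => tm'; first by rewrite addnS.
  by have -> : t = m by lia.
rewrite -[RHS](c_min mL fm) /fweight big_ord_recr /=; congr (_ + _).
  by apply: eq_bigr => t _; rewrite /f ltn_ord ltnW ?ltn_ord // addnS.
by rewrite /f leqnn ltnn.
Qed.

Let W_via v i m : (m.+2 < L)%N -> r (c (i + m)) v -> r v (c i) ->
  W i m + w (c (i + m)) v + w v (c i) = 0.
Proof.
move=> mL e1 e2; pose f t := if (t <= m)%N then c (i + t)%N else if t == m.+1 then v else c i.
have fm : closed_walk f m.+2.
  split; first by rewrite /f leq0n addn0 ifN; [rewrite ifN //; lia|lia].
  rewrite /f => t tm; have [tm'|tm'] := leqP t m.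
    case: ltnP => tm''; first by rewrite addnS.
    by have -> : t = m by [lia]; rewrite eqxx.
  have -> : t = m.+1 by lia.
  by rewrite eqxx ifN; [rewrite ifN //; lia|lia].
rewrite -[RHS](c_min mL fm) /fweight !big_ord_recr /=; congr (_ + _ + _).
- by apply: eq_bigr => t _; rewrite /f ltn_ord ltnW ?ltn_ord // addnS.
- by rewrite /f leqnn ltnn eqxx.
- by rewrite /f ltnn eqxx ifN; [rewrite ifN //; lia|lia].
Qed.

(** A repetition would cut the walk into two shorter closed walks, both of weight 0. *)
Lemma walk_inj i m : (0 < m < L)%N -> c (i + m)%N != c i.
Proof.
move=> /andP[m0 mL]; apply/eqP => e; have /eqP[] := WL i.
have -> : L = (m + (L - m))%N by lia.
rewrite WD W_closed // W_closed ?addr0 //; first lia.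
by rewrite -addnA subnKC ?c_per // ltnW.
Qed.

(** A chord would cut the walk into two shorter closed walks, between which its own weight cancels
    by antisymmetry. *)
Lemma walk_chordless i m : (1 < m)%N -> (m.+1 < L)%N -> r (c (i + m)) (c i) = false.
Proof.
move=> m1 mL; apply/negP => e; have /eqP[] := WL i.
have -> : L = (m + (L - m))%N by lia.
have e' : c (i + m + (L - m)) = c i by rewrite -addnA subnKC ?c_per //; lia.
have := @W_edge (i + m) (L - m); rewrite e' r_sym => /(_ _ e) H.
have := W_edge mL e; move/eqP; rewrite addr_eq0 => /eqP e1; rewrite WD e1.
by rewrite addrC -(w_anti e) H //; lia.
Qed.

Lemma walk_size : (3 < L)%N.
Proof.
have /eqP := WL 0; have := c_per 0; rewrite /W.
case: (L) => [|[|[|[|//]]]] cL []; rewrite ?big_ord_recl big_ord0 /= ?addr0 //.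
- by have := c_r 0; rewrite cL r_irr.
- by rewrite /bump /= cL (w_anti (c_r 0)) subrr.
- by have := c_r 2; rewrite /bump /= cL => c20; rewrite addrA w_tri.
Qed.

(** If v is on the walk, the stretch begins two steps after it. If v is off the walk and adjacent to
    part of it, the stretch begins where v loses contact, and the task is to show that contact is
    not regained within p steps. *)
Lemma walk_far v p : (forall x y z t, r x y -> r y z -> r z t -> r t x ->
    x != z -> y != t -> r x z || r y t) -> (p.+2 < L)%N ->
  exists i, forall t, (0 < t <= p)%N -> c (i + t) != v /\ ~~ r v (c (i + t)).
Proof.
move=> r_sqf pL.
have [[j jv]|nv] := pselect (exists j, c j = v).
  exists j.+1 => t tp; rewrite addSnnS -jv walk_inj; last lia.
  by rewrite r_sym walk_chordless; lia.
have cv j : c j != v by apply/eqP => jv; apply: nv; exists j.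
have [[j [vj vj1]]|nj] := pselect (exists j, r v (c j) /\ ~~ r v (c j.+1)).
  have exm : exists m, (0 < m)%N && r v (c (j + m)) by exists L; rewrite c_per vj; lia.
  case: (ex_minnP exm) => m /andP[m0 vm] mmin.
  exists j => t tp; split=> //; apply/negP => vt.
  have {mmin}mt : (m <= t)%N by apply: mmin; rewrite vt; lia.
  have m1 : m != 1%N by apply: contraNneq vj1 => m1; rewrite -addn1 -m1.
  have [m2|/eqP m2] := eqVneq m 2.
    have := r_sqf v (c j) (c j.+1) (c j.+2) vj (c_r _) (c_r _).
    have -> : c j.+2 = c (j + m) by rewrite m2 addn2.
    rewrite r_sym vm eq_sym cv eq_sym m2 walk_inj ?[r (c j) _]r_sym; last lia.
    by rewrite walk_chordless ?(negbTE vj1); [move=> /(_ isT isT isT)|lia|lia].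
  (* Both arcs between c j and c (j + m) are closed through v. As 2 < m <= p and p + 2 < L, the two
     closed walks are shorter than L and have weight 0; the detours through v cancel, so the whole
     walk would have weight 0. *)
  have e' : c (j + m + (L - m)) = c j by rewrite -addnA subnKC ?c_per //; lia.
  have /eqP[] := WL j; have -> : L = (m + (L - m))%N by lia.
  have := @W_via v j m; rewrite r_sym => /(_ _ vm vj) e1.
  have := @W_via v (j + m) (L - m); rewrite e' r_sym => /(_ _ vj vm) e2.
  move: e1 e2; rewrite (w_anti vm) (w_anti vj) => e1 e2; rewrite WD.
  have /eqP : W j m - w v (c (j + m)) + w v (c j) = 0 by apply: e1; lia.
  rewrite -addrA addr_eq0 opprD opprK => /eqP ->.
  have /eqP : W (j + m) (L - m) - w v (c j) + w v (c (j + m)) = 0 by apply: e2; lia.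
  by rewrite -addrA addr_eq0 opprD opprK => /eqP ->; rewrite addrA subrK subrr.
have step j : r v (c j) -> r v (c j.+1).
  by move=> vj; apply: contrapT => /negP vj1; apply: nj; exists j.
have steps j m : r v (c j) -> r v (c (j + m)).
  by move=> vj; elim: m => [|m IH]; rewrite ?addn0 // addnS step.
have [v0|v0] := boolP (r v (c 0)); last first.
  exists 0%N => t tp; split=> //; apply: contra v0 => /(steps _ (L - t))%N.
  by rewrite add0n subnKC; [rewrite (c_per 0)|lia].
(* Now v is adjacent to the whole walk, and the triangles v, c t, c (t + 1) make the weight
   telescope. *)
have /eqP[] := WL 0; rewrite /W.
rewrite (eq_bigr (fun t : 'I_L => w v (c t.+1) - w v (c t))); last first.
  move=> t _; have vt j : r v (c j) := steps 0%N j v0.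
  have := vt t.+1; rewrite r_sym => tv.
  have := w_tri (c_r t) tv (vt t); rewrite (w_anti (vt t.+1)) => /eqP.
  by rewrite addrAC subr_eq0 => /eqP <-; rewrite addrK.
rewrite -(big_mkord predT (fun t => w v (c t.+1) - w v (c t))) telescope_sumr //.
by rewrite (c_per 0) subrr.
Qed.

End MinimalWalk.

Section Degree2.
Variables (k : fieldType) (n : nat) (G : rel 'I_n).
Hypotheses (G_sym : symmetric G) (G_irr : irreflexive G).
Implicit Types (A B D I J X t : {set 'I_n}) (v a b c x y z : 'I_n) (e : nat).
Implicit Types (f g : {set 'I_n} -> k).

Notation nbhd := (nbhd G).
Notation coh := (coh k G).
Notation clique := (clique G).

Lemma edge_neq x y : G x y -> x != y.
Proof. by apply: contraTneq => ->; rewrite G_irr. Qed.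

(* The value of the 1-cochain f on the edge oriented from x to y. *)
Definition edge_val f x y := if (x < y)%N then f [set x; y] else - f [set x; y].

Lemma edge_valN f x y : x != y -> edge_val f y x = - edge_val f x y.
Proof.
rewrite /edge_val setUC -val_eqE /= => xy.
by case: ltngtP xy => // _ _; rewrite opprK.
Qed.

Lemma cobd_set2 g x y : (x < y)%N -> cobd g [set x; y] = g [set y] - g [set x].
Proof.
move=> xy; have xNy : x \notin [set y] by rewrite inE -val_eqE /= neq_ltn xy.
have yNx : y \notin [set x] by rewrite inE eq_sym; rewrite inE in xNy.
rewrite /cobd big_setU1 //= big_set1 setU1K // [in X in _ + _ * X]setUC setU1K //.
rewrite sgU sgU1 // !sg_set1 xy ltnn ltnNge (ltnW xy) /=.
by rewrite expr0 expr1 mul1r mulr1 mulN1r.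
Qed.

Lemma cobd_set3 g x y z : (x < y)%N -> (y < z)%N ->
  cobd g [set x; y; z] = g [set y; z] - g [set x; z] + g [set x; y].
Proof.
move=> xy yz; have xz := ltn_trans xy yz.
have [nxy nyz nxz] : [/\ x != y, y != z & x != z].
  by rewrite -!val_eqE /= !neq_ltn xy yz xz.
have -> : [set x; y; z] = x |: [set y; z] by rewrite setUA.
have xN : x \notin [set y; z] by rewrite !inE negb_or nxy.
have yN : y \notin [set z] by rewrite inE.
rewrite /cobd big_setU1 //= big_setU1 //= big_set1 setU1K //.
have -> : (x |: [set y; z]) :\ y = [set x; z].
  apply/setP=> t; rewrite !inE; case: (eqVneq t y) => [->|_] //=.
  by rewrite eq_sym (negbTE nxy) (negbTE nyz).
have -> : (x |: [set y; z]) :\ z = [set x; y].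
  apply/setP=> t; rewrite !inE; case: (eqVneq t z) => [->|_] //=; last by rewrite orbF.
  by rewrite eq_sym (negbTE nxz) eq_sym (negbTE nyz).
rewrite sgU !(@sgU1 _ _ _ x) // sgU !(@sgU1 _ _ _ y) // !sg_set1.
rewrite xy yz xz ltnn !ltnNge (ltnW xy) (ltnW yz) (ltnW xz) /=; ring.
Qed.

Lemma edge_val_cobd g x y : x != y -> edge_val (cobd g) x y = g [set y] - g [set x].
Proof.
rewrite /edge_val -val_eqE /= => xy; case: ltngtP xy => // xy _.
  exact: cobd_set2.
by rewrite setUC cobd_set2 // opprB.
Qed.

Lemma clique2 x y : G x y -> clique [set x; y].
Proof.
move=> xy; apply/cliqueP => u v; rewrite !inE.
by case/orP => /eqP-> /orP[]/eqP->; rewrite ?eqxx // G_sym.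
Qed.

Lemma clique3 x y z : G x y -> G y z -> G z x ->
  clique [set x; y; z] /\ #|[set x; y; z]| = 3.
Proof.
move=> xy yz zx; have [[nxy nyz] nzx] := (edge_neq xy, edge_neq yz, edge_neq zx).
split; last first.
  by rewrite -setUA cardsU1 cards2 !inE negb_or nxy nyz eq_sym nzx.
apply/cliqueP => a b; rewrite !inE -!orbA.
by case/or3P => /eqP-> /or3P[] /eqP->; rewrite ?eqxx // ?xy ?yz ?zx // G_sym ?xy ?yz ?zx.
Qed.

(** Two of the eight outcomes of the three comparisons are cyclic and impossible; the other six
    reduce to the increasing order up to sign. *)
Lemma edge_val_tri f D x y z :
  (forall t, t \subset D -> clique t -> #|t| = 3 -> cobd f t = 0) ->
  G x y -> G y z -> G z x -> x \in D -> y \in D -> z \in D ->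
  edge_val f x y + edge_val f y z + edge_val f z x = 0.
Proof.
move=> fD.
have sorted a b c : (a < b)%N -> (b < c)%N -> G a b -> G b c -> G c a ->
    a \in D -> b \in D -> c \in D -> f [set b; c] - f [set a; c] + f [set a; b] = 0.
  move=> ab bc Gab Gbc Gca aD bD cD; have [c3 e3] := clique3 Gab Gbc Gca.
  by rewrite -cobd_set3 // fD // !subUset !sub1set aD bD.
move=> xy yz zx xD yD zD.
have [yx zy xz] : [/\ G y x, G z y & G x z] by rewrite G_sym xy G_sym yz G_sym zx.
rewrite /edge_val; move: (edge_neq xy) (edge_neq yz) (edge_neq zx); rewrite -!val_eqE /=.
case: (ltngtP x y) => // h1 _; case: (ltngtP y z) => // h2 _; case: (ltngtP z x) => // h3 _.
- by have := ltn_trans h1 (ltn_trans h2 h3); rewrite ltnn.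
- have := sorted _ _ _ h1 h2 xy yz zx xD yD zD; rewrite [[set z; x]]setUC => <-; ring.
- have := sorted _ _ _ h3 h1 zx xy yz zD xD yD; rewrite [[set z; y]]setUC => <-; ring.
- have := sorted _ _ _ h3 h2 xz zy yx xD zD yD.
  rewrite [[set z; y]]setUC [[set z; x]]setUC => /(congr1 -%R); rewrite oppr0 => <-; ring.
- have := sorted _ _ _ h2 h3 yz zx xy yD zD xD; rewrite [[set y; x]]setUC => <-; ring.
- have := sorted _ _ _ h1 h3 yx xz zy yD xD zD.
  rewrite [[set y; x]]setUC [[set z; x]]setUC => /(congr1 -%R); rewrite oppr0 => <-; ring.
- have := sorted _ _ _ h2 h1 zy yx xz zD yD xD.
  rewrite [[set z; y]]setUC [[set z; x]]setUC [[set y; x]]setUC.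
  by move=> /(congr1 -%R); rewrite oppr0 => <-; ring.
- by have := ltn_trans h1 (ltn_trans h3 h2); rewrite ltnn.
Qed.

End Degree2.

Section Holes.
Variables (k : fieldType) (n : nat) (G : rel 'I_n).
Hypotheses (G_sym : symmetric G) (G_irr : irreflexive G).
Implicit Types (A B D I J X K W : {set 'I_n}) (v a b c d x y z : 'I_n) (e : nat).
Implicit Types (f g : {set 'I_n} -> k).

Notation nbhd := (nbhd G).
Notation coh := (coh k G).
Notation clique := (clique G).
Notation far := (far G).
Notation edge_neq := (edge_neq G_irr).

Variable p : nat.
Hypothesis p_gt1 : (1 < p)%N.
Hypothesis small_acyclic : forall W, (2 < #|W| < p.+3)%N -> ~ coh 2 W W.

(** A clique meets a nonadjacent pair at most once. The case a = c is allowed and serves the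
    pentagon. *)
Lemma clique_two_pairs (t : {set 'I_n}) a b c d : clique t -> ~~ G a c -> ~~ G b d ->
  t \subset [set a; c] :|: [set b; d] -> (#|t| <= 2)%N.
Proof.
move=> /cliqueP ct ac bdry ts.
have pair x y : ~~ G x y -> (#|t :&: [set x; y]| <= 1)%N.
  move=> xy; apply/card_le1_eqP => u v; rewrite !inE => /andP[ut uxy] /andP[vt vxy].
  apply/eqP; apply: contraNT xy => uv; have := ct _ _ ut vt; rewrite eq_sym in uv.
  by case/orP: uxy vxy uv => /eqP-> /orP[]/eqP->; rewrite ?eqxx //= 1?eq_sym 1?G_sym => ? ->.
rewrite -(setIidPl ts) setIUr.
exact: leq_trans (leq_card_setU _ _) (leq_add (pair _ _ ac) (pair _ _ bdry)).
Qed.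

(** The cocycle is the indicator of the edge ab. A primitive would be constant along all other edges
    of W, which by the last hypothesis still connect a with b. *)
Lemma coh2_of_no_triangle W a b : G a b -> a \in W -> b \in W ->
  (forall t : {set 'I_n}, t \subset W -> clique t -> (#|t| <= 2)%N) ->
  (forall g : 'I_n -> k, (forall x y, G x y -> x \in W -> y \in W ->
     [set x; y] != [set a; b] -> g x = g y) -> g a = g b) -> coh 2 W W.
Proof.
move=> ab aW bW W3 Wg; exists (fun t : {set 'I_n} => (t == [set a; b])%:R) => [t tW ct t3|[g gP]].
  by have := W3 t tW ct; rewrite t3.
have edge x y : G x y -> x \in W -> y \in W ->
    edge_val (fun t : {set 'I_n} => (t == [set a; b])%:R) x y = g [set y] - g [set x].
  move=> xy xW yW; rewrite -edge_val_cobd ?edge_neq //.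
  have gxy := gP [set x; y]; rewrite /edge_val gxy //.
  - by rewrite subUset !sub1set xW.
  - exact: clique2.
  - by rewrite cards2 edge_neq.
have := edge _ _ ab aW bW; rewrite (Wg (fun x => g [set x])) => [|x y xy xW yW ne].
  by rewrite subrr /edge_val eqxx; case: ifP => _ /eqP; rewrite ?oppr_eq0 oner_eq0.
have /eqP := edge _ _ xy xW yW; rewrite /edge_val (negbTE ne) oppr0 if_same.
by rewrite eq_sym subr_eq0 => /eqP.
Qed.

Lemma acyclic_square_free : square_free G.
Proof.
move=> a b c d ab bc cd da ac bdry; apply: contraT; rewrite negb_or => /andP[nac nbd].
have [[nab nbc] [ncd nda]] := (edge_neq ab, edge_neq bc, (edge_neq cd, edge_neq da)).
pose W := [set a; c] :|: [set b; d].
have W4 : #|W| = 4%N.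
  rewrite cardsU !cards2 ac bdry (_ : _ :&: _ = set0) ?cards0 //.
  apply/setP=> x; rewrite !inE; apply/negbTE/negP => /andP[/orP[]/eqP-> /orP[]/eqP H];
  by move: nab nbc ncd nda; rewrite H eqxx.
case: (@small_acyclic W); first by rewrite W4 !ltnS.
apply: (coh2_of_no_triangle ab); rewrite ?inE ?eqxx ?orbT //.
  by move=> t tW ct; apply: clique_two_pairs ct nac nbd tW.
move=> g gW; have aux x y z : x \notin [set y; z] -> [set y; z] != [set x; b].
  by apply: contraNneq => ->; rewrite !inE eqxx.
have aux' x y z : x \notin [set y; z] -> [set y; z] != [set a; x].
  by apply: contraNneq => ->; rewrite !inE eqxx orbT.
rewrite -(gW d a) ?(gW d c) ?(gW b c) //; do ?[by rewrite !inE eqxx ?orbT].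
- by apply: aux; rewrite !inE negb_or nab.
- by rewrite G_sym.
- by apply: aux; rewrite !inE negb_or ac eq_sym nda.
- by apply: aux'; rewrite !inE negb_or bdry eq_sym nab.
Qed.

Lemma acyclic_pentagon_free : (2 < p)%N -> pentagon_free G.
Proof.
move=> p3 a b c d e ab bc cd de ea; apply: contraT; rewrite !negb_or.
case/and5P=> nac nbd nce nda neb.
have [[nab nbc] [ncd [nde nea]]] :=
  (edge_neq ab, edge_neq bc, (edge_neq cd, (edge_neq de, edge_neq ea))).
have ac : a != c by apply: contraNneq nda => ->; rewrite G_sym.
have ad : a != d by apply: contraNneq nac => ->; rewrite G_sym.
have bdry : b != d by apply: contraNneq nda => <-; rewrite G_sym.
have be : b != e by apply: contraNneq nce => <-; rewrite G_sym.
have ce : c != e by apply: contraNneq nac => ->; rewrite G_sym.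
pose W := [set x in [:: a; b; c; d; e]].
have W5 : #|W| = 5%N.
  rewrite cardsE; apply/card_uniqP => /=; rewrite !inE !negb_or nab ac ad nbc bdry be ncd ce nde.
  by rewrite eq_sym nea.
case: (@small_acyclic W); first by rewrite W5 !ltnS.
apply: (coh2_of_no_triangle ab); rewrite ?inE ?eqxx ?orbT //.
  move=> t tW ct; have [a_t|a_t] := boolP (a \in t).
    apply: (@clique_two_pairs t a b a e) => //; first by rewrite G_irr.
      by rewrite G_sym.
    apply/subsetP => x xt; have := subsetP tW _ xt; have := cliqueP _ _ ct _ _ a_t xt.
    rewrite !inE; case: (eqVneq x c) => [->|_]; first by rewrite (negbTE nac) => /(_ ac).
    case: (eqVneq x d) => [->|_]; first by rewrite G_sym (negbTE nda) => /(_ ad).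
    by move=> _ /=; case: (x == a).
  apply: (@clique_two_pairs t b c d e) => //.
  apply/subsetP => x xt; have := subsetP tW _ xt; rewrite !inE.
  have /negbTE -> /= : x != a by apply: contraNneq a_t => <-.
  by case/or4P => ->; rewrite ?orbT.
move=> g gW; have aux x y z : x \notin [set y; z] -> [set y; z] != [set x; b].
  by apply: contraNneq => ->; rewrite !inE eqxx.
have aux' x y z : x \notin [set y; z] -> [set y; z] != [set a; x].
  by apply: contraNneq => ->; rewrite !inE eqxx orbT.
rewrite -(gW e a) -?(gW d e) -?(gW c d) ?(gW b c) //; do ?[by rewrite !inE eqxx ?orbT].
- by apply: aux; rewrite !inE negb_or nab.
- by apply: aux; rewrite !inE negb_or ac.
- by apply: aux; rewrite !inE negb_or ad eq_sym nea.
- by apply: aux'; rewrite !inE negb_or be eq_sym nab.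
Qed.

(* The hole is a shortest closed walk on which some cocycle has nonzero weight. *)
Lemma hole D : coh 2 D D -> exists (c : nat -> 'I_n) (L : nat), [/\ (p.+2 < L)%N,
  forall i m, (0 < m < L)%N -> c (i + m)%N != c i,
  forall i m, (1 < m)%N -> (m.+1 < L)%N -> ~~ G (c (i + m)%N) (c i),
  forall i, c i \in D &
  forall v, v \in D -> exists i : nat, forall t : nat, (0 < t <= p)%N -> c (i + t)%N \in far D v].
Proof.
move=> [f fD fN]; pose r x y := [&& G x y, x \in D & y \in D].
pose w := edge_val f.
have r_sym : symmetric r by move=> x y; rewrite /r G_sym [(x \in D) && _]andbC.
have r_irr : irreflexive r by move=> x; rewrite /r G_irr.
have w_anti x y : r x y -> w y x = - w x y by case/and3P=> /edge_neq xy _ _; apply: edge_valN.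
have w_tri x y z : r x y -> r y z -> r z x -> w x y + w y z + w z x = 0.
  by case/and3P=> xy xD yD /and3P[yz _ zD] /and3P[zx _ _]; apply: (edge_val_tri G_sym G_irr fD).
have [f0 [m [fm wm]]] : exists (q : nat -> 'I_n) (m : nat), closed_walk r q m /\ fweight w q m != 0.
  apply: contrapT => nW; apply: fN.
  have [x s ps ls|g gP] := potential r_sym (w := w).
    apply/eqP; apply: contrapT => /negP ws; apply: nW.
    by have [h [m [hm e]]] := closed_walk_of_path w ps ls; exists h, m; rewrite e.
  exists (fun s : {set 'I_n} => if [pick x in s] is Some x then g x else 0).
  move=> t tD ct /eqP/cards2P[x [y [xy te]]].
  have rxy : r x y.
    rewrite te in tD ct; move: tD; rewrite subUset !sub1set => /andP[xD yD].
    by rewrite /r xD yD !andbT; apply: (cliqueP _ _ ct); rewrite ?inE ?eqxx ?orbT.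
  have := gP _ _ rxy; set g' := (g' in cobd g').
  have g1 z : g' [set z] = g z.
    by rewrite /g'; case: pickP => [u|/(_ z)]; rewrite inE ?eqxx // => /eqP ->.
  rewrite -!g1 -edge_val_cobd // /w /edge_val te; by case: ifP => // _ /oppr_inj.
have [c [L [cL cr cw cmin]]] := minimal_walk fm wm.
have cD i : c i \in D by case/and3P: (cr i).
have c_inj := walk_inj cL cr cw cmin.
have c_chord := walk_chordless r_sym w_anti cL cr cw cmin.
have L4 := walk_size r_irr w_anti w_tri cL cr cw.
(* On at most p + 2 vertices f would be a coboundary by [small_acyclic], and the weight of the walk
   would telescope to 0. *)
have pL : (p.+2 < L)%N.
  rewrite ltnNge; apply/negP => Lp.
  pose W := [set c i | i : 'I_L].
  have WD : W \subset D by apply/subsetP => x /imsetP[i _ ->].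
  have cW i : (i < L)%N -> c i \in W by move=> iL; apply/imsetP; exists (Ordinal iL).
  case: (@small_acyclic W).
    rewrite card_imset ?card_ord; first by rewrite (ltn_trans _ L4).
    move=> i j /eqP ij; apply/ord_inj/eqP; move: ij; apply: contraTT.
    rewrite neq_ltn => /orP[] ij; [rewrite eq_sym|];
      rewrite -(subnKC (ltnW ij)) c_inj // subn_gt0 ij;
      exact: leq_ltn_trans (leq_subr _ _) (ltn_ord _).
  exists f => [t tW|[g gW]]; first by apply: fD; apply: subset_trans WD.
  have /eqP[] := cw; have c0 : c L = c 0%N := cL 0%N.
  rewrite /fweight (eq_bigr (fun t : 'I_L => g [set c t.+1] - g [set c t])).
    rewrite -(big_mkord predT (fun t : nat => g [set c t.+1] - g [set c t])) telescope_sumr //.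
    by rewrite c0 subrr.
  move=> t _; case/and3P: (cr t) => Gt _ _.
  rewrite -edge_val_cobd ?edge_neq // /w /edge_val gW //.
  - rewrite subUset !sub1set cW //=.
    have [->|/eqP tL] := eqVneq t.+1 L; first by rewrite c0 cW //; lia.
    by apply: cW; have := ltn_ord t; lia.
  - exact: clique2.
  - by rewrite cards2 edge_neq.
exists c, L; split=> // [i m'|v vD].
  by move=> m1 mL; have := c_chord i m' m1 mL; rewrite /r !cD !andbT => ->.
have r_sqf x y z u : r x y -> r y z -> r z u -> r u x -> x != z -> y != u -> r x z || r y u.
  case/and3P=> xy xD yD /and3P[yz _ zD] /and3P[zu _ uD] /and3P[ux _ _] xz yu.
  by rewrite /r xD yD zD uD !andbT; apply: acyclic_square_free.
have [i iP] := walk_far r_sym w_anti w_tri cL cr cw cmin v r_sqf pL.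
exists i => t tp; have [cv] := iP t tp; rewrite in_far cv cD /r cD vD !andbT.
by [].
Qed.

(** The vertices are p consecutive ones of the hole; those at the odd offsets 2t + 1 <= p are ceil(p
    / 2) pairwise nonadjacent ones. *)
Lemma far_bound2 : far_bound k G 2 p (uphalf p).
Proof.
move=> D v vD /hole[c [L [pL c_inj c_chord cD /(_ v vD)[i iP]]]].
have inj s t : (s < t)%N -> (t < s + L)%N -> c (i + t)%N != c (i + s)%N.
  move=> st tL; have -> : (i + t = i + s + (t - s))%N by lia.
  by apply: c_inj; lia.
split.
  have <- : #|[set c (i + t.+1)%N | t : 'I_p]| = p.
    rewrite card_imset ?card_ord // => s t /eqP st; apply/ord_inj/eqP; move: st.
    by apply: contraTT; have := (ltn_ord s, ltn_ord t); rewrite neq_ltn => -[] ? ? /orP[] st;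
      [rewrite eq_sym|]; apply: inj; lia.
  by apply/subset_leq_card/subsetP => x /imsetP[t _ ->]; apply: iP; have := ltn_ord t; lia.
exists [set c (i + t.*2.+1)%N | t : 'I_(uphalf p)].
  apply/subsetP => x /imsetP[t _ ->]; apply: iP; have := ltn_ord t; lia.
have chord (s t : nat) : (s < t)%N -> (t < uphalf p)%N ->
    ~~ G (c (i + t.*2.+1)%N) (c (i + s.*2.+1)%N).
  move=> st tp; have -> : (i + t.*2.+1 = i + s.*2.+1 + (t - s).*2)%N by lia.
  by apply: c_chord; lia.
apply/andP; split.
  apply/indepP => x y /imsetP[s _ ->] /imsetP[t _ ->].
  by case: (ltngtP s t) => [st|ts|->]; rewrite ?G_irr //; [rewrite G_sym|]; apply: chord.
rewrite card_imset ?card_ord // => s t /eqP st; apply/ord_inj/eqP; move: st.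
by apply: contraTT; have := (ltn_ord s, ltn_ord t); rewrite neq_ltn => -[] ? ? /orP[] st;
  [rewrite eq_sym|]; apply: inj; lia.
Qed.

Lemma coh2_not_two_cliques D K1 K2 : coh 2 D D -> clique K1 -> clique K2 ->
  ~~ (D \subset K1 :|: K2).
Proof.
move=> /hole[c [L [pL c_inj c_chord cD _]]] /cliqueP cK1 /cliqueP cK2.
apply/negP => /subsetP DK; have inK i : (c i \in K1) || (c i \in K2) by rewrite -in_setU DK.
have no i m : (1 < m)%N -> (m.+1 < L)%N ->
    ~~ ((c i \in K1) && (c (i + m)%N \in K1)) && ~~ ((c i \in K2) && (c (i + m)%N \in K2)).
  move=> m1 mL; have ne : c (i + m)%N != c i by apply: c_inj; lia.
  apply/andP; split; apply: contra (c_chord i m m1 mL) => /andP[ci cm]; [exact: cK1|exact: cK2].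
(* These five nonadjacent pairs form the odd cycle 0, 2, 4, 1, 3, which K1 and K2 would have to
   colour properly with two colours. *)
move: (no 0 2 isT) (no 2 2 isT) (no 1 3 isT) (no 1 2 isT) (no 0 3 isT) => /=.
have L5 : (4 < L)%N by lia.
rewrite L5 (ltnW L5) !add0n /= => /(_ isT) h1 /(_ isT) h2 /(_ isT) h3 /(_ isT) h4 /(_ isT) h5.
move: (inK 0%N) (inK 1%N) (inK 2%N) (inK 3%N) (inK 4%N) h1 h2 h3 h4 h5.
rewrite -[(2 + 2)%N]/4%N -[(1 + 3)%N]/4%N -[(1 + 2)%N]/3%N.
by do 5! [case: (_ \in K1); case: (_ \in K2)].
Qed.

End Holes.

(** * The lower bound for the number of vertices *)

Section VertexBound.
Variables (k : fieldType) (n : nat) (G : rel 'I_n).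
Hypotheses (G_sym : symmetric G) (G_irr : irreflexive G).
Variable p : nat.
Hypothesis p_gt1 : (1 < p)%N.
Hypothesis small_acyclic : forall W : {set 'I_n}, (2 < #|W| < p.+3)%N -> ~ coh k G 2 W W.

Let sqf : square_free G := acyclic_square_free G_sym G_irr p_gt1 small_acyclic.
Let base : far_bound k G 2 p (uphalf p) := far_bound2 G_sym G_irr p_gt1 small_acyclic.

(** The step from index 2 to 3 multiplies the bound by 1 + ceil(p / 2) and raises the independence
    bound by one; each later step keeps the latter and multiplies by ceil(p / 2) + 2. *)
Lemma far_boundS e :
  far_bound k G e.+3 ((uphalf p).+2 ^ e * ((uphalf p).+1 * p)) (uphalf p).+1.
Proof.
elim: e => [|e IH].
  rewrite expn0 mul1n -add1n; apply: (far_step G_sym G_irr sqf base) => D v vD HD.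
  have [p3|p2] := ltnP 2 p.
    have [I If /andP[iI cI]] :=
      far_indep_sq G_sym G_irr sqf (acyclic_pentagon_free G_sym G_irr small_acyclic p3) base vD HD.
    exists I => //; rewrite iI /=; apply: leq_trans cI.
    have : (1 < uphalf p)%N by lia.
    by case: (uphalf p) => [|[|u]] // _; rewrite mulSn mulnS; lia.
  have -> : p = 2 by lia.
  apply: (far_indep2 G_sym G_irr sqf _ _ base) vD HD; rewrite ?uphalf_gt0; try lia.
  exact: (coh2_not_two_cliques G_sym G_irr p_gt1 small_acyclic).
rewrite expnS -mulnA -add1n; apply: (far_step G_sym G_irr sqf IH) => D v vD HD.
exact: (far_indep_mono G_sym G_irr sqf) IH vD HD.
Qed.

Lemma card_coh_ge e (D : {set 'I_n}) : coh k G e.+3 D D ->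
  ((uphalf p).+2 ^ e * ((uphalf p).+1 * p) <= #|D|)%N.
Proof.
move=> HD; have /set0Pn[v vD] := coh_neq0 HD.
have [hD _] := far_boundS vD HD; apply: leq_trans hD _.
by apply: subset_leq_card; apply: subsetDl.
Qed.

End VertexBound.

(** * Koszul homology of the non-edge ideal *)

Section SimplexBoundary.
Variables (k : fieldType) (n : nat).
Implicit Types (s t W : {set 'I_n}) (f g : {set 'I_n} -> k) (x y : 'I_n).

(** Boundary of chains of the full simplex, empty face included. The Koszul differential becomes
    this map in each multidegree. *)
Definition bdry g s := \sum_(x | x \notin s) sg k x s * g (x |: s).

Definition cone x g s := if x \in s then sg k x s * g (s :\ x) else 0.

Lemma bdry_cone x g s : (forall t, bdry g t = 0) -> bdry (cone x g) s = g s.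
Proof.
move=> g0; have [xs|xs] := boolP (x \in s); last first.
  rewrite /bdry (bigD1 x) //= big1 ?addr0 => [|y /andP[ys yx]]; last first.
    by rewrite /cone !inE (negbTE xs) eq_sym (negbTE yx) mulr0.
  by rewrite /cone setU11 sgU setU1K // mulrA sg_sqr mul1r.
have [t xt ->] : exists2 t : {set 'I_n}, x \notin t & s = x |: t.
  by exists (s :\ x); rewrite ?setD1K // !inE eqxx.
have := g0 t; rewrite /bdry (bigD1 x) //= => /eqP; rewrite addr_eq0 => /eqP gt.
apply: (mulrI (x := sg k x t)); first by apply/unitrPr; exists (sg k x t); rewrite sg_sqr.
rewrite gt big_distrr /= -sumrN; apply: eq_big => [y|y].
  by rewrite !inE negb_or andbC.
rewrite !inE negb_or => /andP[yx yt]; rewrite /cone !inE eqxx orbT.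
have -> : (y |: (x |: t)) :\ x = y |: t.
  by rewrite setUCA setU1K // !inE negb_or eq_sym yx.
rewrite setUCA sgU !mulrA -mulNr; congr (_ * _).
have xy : x != y by rewrite eq_sym.
have e := @sg_antiU k n x y t xt yt xy.
apply: (mulrI (x := sg k x (y |: t))).
  by apply/unitrPr; exists (sg k x (y |: t)); rewrite sg_sqr.
rewrite mulrN e [_ * (_ * _)]mulrC -!mulrA sg_sqr; ring.
Qed.

(** By [sg_compl] the signs of x in s and in W minus s differ by the sign of x in W; this product
    collects the differences. *)
Definition sgW W t := \prod_(x in t) sg k x W.

Lemma sgW_sqr W t : sgW W t * sgW W t = 1.
Proof. by rewrite -big_split big1 //= => x _; rewrite sg_sqr. Qed.

(* Up to signs, complementation in W exchanges the coboundary and the boundary. *)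
Definition compl_dual W f s := if s \subset W then sgW W (W :\: s) * f (W :\: s) else 0.

Lemma compl_dualD W f t : t \subset W -> compl_dual W f (W :\: t) = sgW W t * f t.
Proof. by move=> tW; rewrite /compl_dual subsetDl setDDr setDv set0U (setIidPr tW). Qed.

Lemma compl_dualK W g s : (forall s, g s != 0 -> s \subset W) ->
  compl_dual W (fun t => sgW W t * g (W :\: t)) s = g s.
Proof.
move=> gW; rewrite /compl_dual; case: ifP => sW; last first.
  by apply/esym/eqP; apply: contraFT sW => /gW.
by rewrite mulrA sgW_sqr mul1r setDDr setDv set0U (setIidPr sW).
Qed.

Lemma bdry_compl_dual W f s : bdry (compl_dual W f) s = compl_dual W (cobd f) s.
Proof.
rewrite /compl_dual /sgW; have [sW|sW] := boolP (s \subset W); last first.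
  by rewrite /bdry big1 // => x _; rewrite subUset (negbTE sW) andbF mulr0.
rewrite /bdry (bigID (mem W)) /= [X in _ + X]big1 ?addr0 => [|x /andP[_ xW]]; last first.
  by rewrite subUset sub1set (negbTE xW) mulr0.
rewrite /cobd big_distrr; apply: eq_big => [x|x /andP[xs xW]]; first by rewrite !inE.
have -> : W :\: (x |: s) = W :\: s :\ x by rewrite setDDl setUC.
rewrite subUset sub1set xW sW [in RHS](big_setD1 x) ?inE ?xs //= (sg_compl k x sW); ring.
Qed.

End SimplexBoundary.

Section FineGrading.
Variables (k : fieldType) (n : nat).
Implicit Types (s t W : {set 'I_n}) (g : {set 'I_n} -> k) (x y : 'I_n).
Implicit Types (b m : 'X_{1..n}) (c : {set 'I_n} -> {mpoly k[n]}).

Definition set_mnm s : 'X_{1..n} := [multinom (i \in s : nat) | i < n].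

Lemma set_mnmE s i : set_mnm s i = (i \in s).
Proof. exact: mnmE. Qed.

Lemma mdeg_set_mnm s : mdeg (set_mnm s) = #|s|.
Proof.
rewrite mdegE (eq_bigr (fun i => (i \in s) : nat)); last by move=> i _; rewrite set_mnmE.
by rewrite -big_mkcond sum1_card.
Qed.

Lemma set_mnm_le s t : (set_mnm s <= set_mnm t)%MM = (s \subset t).
Proof.
apply/mnm_lepP/subsetP => st x; last by rewrite !set_mnmE; have := st x; case: (x \in s) => // ->.
by move=> xs; have := st x; rewrite !set_mnmE xs; case: (x \in t).
Qed.

(* c s is the coefficient of the wedge of the e_x with x in s. *)
Definition koszul c s := \sum_(x | x \notin s) sg {mpoly k[n]} x s * 'X_x * c (x |: s).

(* The part of c of multidegree b, where e_x has the degree of 'X_x. *)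
Definition fine_comp b c s := if (set_mnm s <= b)%MM then (c s)@_(b - set_mnm s) else 0.

Lemma fine_comp_koszul b c s : fine_comp b (koszul c) s = bdry (fine_comp b c) s.
Proof.
rewrite /fine_comp; case: ifP => sb; last first.
  rewrite /bdry big1 // => x xs; rewrite ifN ?mulr0 //; apply: contraFN sb => /mnm_lepP xb.
  apply/mnm_lepP => y; apply: leq_trans (xb y); rewrite !set_mnmE !inE.
  by case: (y \in s); rewrite ?orbT.
rewrite /koszul /bdry raddf_sum; apply: eq_bigr => x xs /=.
have -> : sg {mpoly k[n]} x s = (sg k x s)%:MP by rewrite /sg rmorphXn rmorphN rmorph1.
rewrite -mulrA mcoeffCM; congr (_ * _).
have [xb|xb] := boolP (0 < b x)%N.
  have xsb : (set_mnm (x |: s) <= b)%MM.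
    apply/mnm_lepP => y; rewrite set_mnmE !inE.
    have := mnm_lepP sb y; rewrite set_mnmE.
    by case: eqVneq => //= ->.
  rewrite xsb mulrC (_ : (b - set_mnm s)%MM = (U_(x) + (b - set_mnm (x |: s)))%MM) ?mcoeffMX //.
  apply/mnmP => y; rewrite mnmDE !mnmBE !set_mnmE mnm1E !inE.
  case: (eqVneq y x) => [->|yx] /=; last by rewrite add0n.
  by rewrite (negbTE xs) subn0 add1n subn1 prednK.
rewrite ifN; last first.
  apply: contra xb => /mnm_lepP/(_ x); by rewrite set_mnmE setU11.
rewrite mulrC; apply/eqP; rewrite mcoeff_eq0 (perm_mem (msuppMX _ _)).
apply/mapP => -[m _ /mnmP/(_ x)]; rewrite mnmBE mnmDE mnm1E eqxx.
by move: xb; rewrite lt0n negbK => /eqP ->.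
Qed.

Lemma fine_comp_inj c c' : (forall b s, fine_comp b c s = fine_comp b c' s) -> c =1 c'.
Proof.
move=> H s; apply/mpolyP => m; have := H (m + set_mnm s)%MM s.
rewrite /fine_comp; have -> : (set_mnm s <= m + set_mnm s)%MM.
  by apply/mnm_lepP => i; rewrite mnmDE leq_addl.
have -> // : (m + set_mnm s - set_mnm s)%MM = m.
by apply/mnmP => i; rewrite mnmBE mnmDE addnK.
Qed.

(** Preimages can be chosen in each multidegree separately. [Q] controls their support, so that they
    can be kept inside the ideal. *)
Lemma koszul_lift c (Q : 'X_{1..n} -> {set 'I_n} -> Prop) :
  (forall b, exists2 g, forall s, bdry g s = fine_comp b c s &
     forall s, g s != 0 -> (set_mnm s <= b)%MM /\ Q b s) ->
  exists2 y, koszul y =1 c & forall b s, fine_comp b y s != 0 -> Q b s.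
Proof.
move=> H; have /choice[h hP] b : exists g, (forall s, bdry g s = fine_comp b c s) /\
     (forall s, g s != 0 -> (set_mnm s <= b)%MM /\ Q b s).
  by have [g] := H b; exists g.
(* The components of c of total degree at least N vanish, so the choices can be truncated there and
   add up to polynomials. *)
pose N := \max_(s : {set 'I_n}) (msize (c s) + #|s|)%N.
have cN b s : (N <= mdeg b)%N -> fine_comp b c s = 0.
  move=> Nb; rewrite /fine_comp; case: ifP => // /mnm_lepP sb.
  apply/eqP; rewrite mcoeff_eq0; apply/negP => /msize_mdeg_lt.
  apply/negP; rewrite -leqNgt -(leq_add2r #|s|).
  apply: leq_trans (_ : N <= _)%N.
    exact: (@leq_bigmax _ (fun s : {set 'I_n} => (msize (c s) + #|s|)%N)).
  apply: (leq_trans Nb).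
  rewrite -mdeg_set_mnm -mdegD (_ : (b - set_mnm s + set_mnm s)%MM = b) //.
  by apply/mnmP => i; rewrite mnmDE mnmBE subnK.
pose g b s := if (mdeg b < N)%N then h b s else 0.
pose y s := \sum_(m : 'X_{1..n < N}) g (m + set_mnm s)%MM s *: 'X_[m] : {mpoly k[n]}.
have yE b s : fine_comp b y s = g b s.
  rewrite /fine_comp; case: ifP => sb; last first.
    rewrite /g; case: ifP => // _; apply/esym/eqP; apply: contraFT sb => hb.
    by have [] := (hP b).2 s hb.
  have bE : (b - set_mnm s + set_mnm s)%MM = b.
    by apply/mnmP => i; rewrite mnmDE mnmBE subnK //; apply: (mnm_lepP sb).
  have [bN|bN] := ltnP (mdeg (b - set_mnm s)%MM) N.
    by rewrite (mcoeff_mpoly (fun m => g (m + set_mnm s)%MM s)) // bE.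
  rewrite raddf_sum big1 => [|m _] /=; last first.
    rewrite mcoeffZ mcoeffX; case: eqP => [mb|_]; last by rewrite mulr0.
    by have := bmdeg m; rewrite mb ltnNge bN.
  rewrite /g ifN // -leqNgt -bE mdegD; apply: leq_trans bN _; exact: leq_addr.
exists y => [|b s]; last first.
  by rewrite yE /g; case: ifP => [_ /(hP b).2[]|]; rewrite ?eqxx.
apply: fine_comp_inj => b s; rewrite fine_comp_koszul.
rewrite /bdry (eq_bigr (fun x => sg k x s * g b (x |: s))) => [|x _]; last by rewrite yE.
rewrite /g; case: ltnP => bN; first exact: (hP b).1.
by rewrite cN // big1 // => x _; rewrite mulr0.
Qed.

(** A multidegree b other than 0 admits the cone over a variable that occurs in b; in multidegree 0
    there is only the constant term at [set0]. *)
Lemma koszul_exact c : (forall s, koszul c s = 0) -> (c set0)@_0 = 0 ->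
  exists d : {set 'I_n} -> {mpoly k[n]}, koszul d =1 c.
Proof.
move=> c0 c00; have [b|y yc _] := @koszul_lift c (fun _ _ => True); last by exists y.
have bd0 t : bdry (fine_comp b c) t = 0.
  rewrite -fine_comp_koszul /fine_comp; case: ifP => // _; by rewrite c0 mcoeff0.
have [->|/eqP b0] := eqVneq b 0%MM.
  exists (fun _ => 0) => [s|s]; last by rewrite eqxx.
  rewrite /bdry big1 => [|x _]; last by rewrite mulr0.
  rewrite /fine_comp; case: ifP => // /mnm_lepP s0.
  have -> : s = set0.
    apply/setP=> x; have := s0 x; rewrite set_mnmE mnm0E inE; by case: (x \in s).
  have -> : (0 - set_mnm set0)%MM = 0%MM :> 'X_{1..n} by apply/mnmP => i; rewrite mnmBE !mnm0E.
  by rewrite c00.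
have [x xb] : exists x, (0 < b x)%N.
  apply: contrapT => nx; apply: b0; apply/mnmP => x; rewrite mnm0E.
  apply/eqP; rewrite -leqn0 leqNgt; apply/negP => bx; apply: nx; by exists x.
exists (cone x (fine_comp b c)) => [s|s]; first exact: bdry_cone.
rewrite /cone; case: ifP => xs; rewrite ?eqxx // => H; split=> //.
move: H; rewrite /fine_comp; case: ifP => [/mnm_lepP sb _|]; last by rewrite mulr0 eqxx.
apply/mnm_lepP => y; have := sb y; rewrite !set_mnmE !inE.
by case: eqVneq => [->|//]; case: (x \in s).
Qed.
End FineGrading.

Section NonedgeIdeal.
Variables (k : fieldType) (n : nat) (G : rel 'I_n).
Implicit Types (s t W : {set 'I_n}) (x : 'I_n) (b m : 'X_{1..n}).
Implicit Types (f : {mpoly k[n]}) (z : {set 'I_n} -> {mpoly k[n]}).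

Notation clique := (clique G).
Notation coh := (coh k G).

Definition mnm_supp b := [set i | (0 < b i)%N].

Lemma nonedge_idealD f1 f2 : nonedge_ideal k G f1 -> nonedge_ideal k G f2 ->
  nonedge_ideal k G (f1 + f2).
Proof.
move=> [c1 ->] [c2 ->]; exists (fun i j => c1 i j + c2 i j).
rewrite -big_split; apply: eq_bigr => i _; rewrite -big_split.
by apply: eq_bigr => j _; rewrite /= mulrDl.
Qed.

(** I(G) is the Stanley-Reisner ideal of the clique complex; as a monomial ideal it is tested on the
    supports of monomials. *)
Lemma nonedge_idealP f : nonedge_ideal k G f <->
  forall m, m \in msupp f -> ~~ clique (mnm_supp m).
Proof.
split=> [[c ->] m|H].
  rewrite mcoeff_msupp; apply: contraNN => cm; rewrite raddf_sum big1 // => i _.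
  rewrite raddf_sum big1 // => j /andP[ij nij]; rewrite -mpolyXD /=.
  apply/eqP; rewrite mcoeff_eq0 (perm_mem (msuppMX _ _)); apply/mapP => -[m' _ mE].
  case/negP: nij; apply: (cliqueP _ _ cm) => //; rewrite inE mE !mnmDE !mnm1E eqxx //.
  by rewrite addn1.
rewrite [f]mpolyE big_seq; apply: (big_ind (nonedge_ideal k G)).
- exists (fun _ _ => 0); rewrite big1 // => i _; rewrite big1 // => j _; by rewrite mul0r.
- exact: nonedge_idealD.
move=> m /H; rewrite negb_forall_in => /existsP[i /andP[im]].
rewrite negb_forall_in => /existsP[j /andP[jm]]; rewrite negb_imply => /andP[ij nij].
exists (fun i' j' => if (i' == i) && (j' == j) then f@_m *: 'X_[m - (U_(i) + U_(j))] else 0).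
rewrite (bigD1 i) //= [X in _ + X]big1 ?addr0 => [|i' ii']; last first.
  by rewrite big1 // => j' _; rewrite (negbTE ii') mul0r.
rewrite (bigD1 j) ?ij //= [X in _ + X]big1 ?addr0 => [|j' /andP[_ jj']]; last first.
  by rewrite (negbTE jj') andbF mul0r.
rewrite !eqxx /= -mpolyXD -scalerAl -mpolyXD; congr (_ *: 'X_[_]).
apply/mnmP => y; rewrite !mnmDE mnmBE !mnmDE subnK // !mnm1E.
rewrite !inE in im jm; case: (eqVneq i y) => [<-|iy]; last by case: (eqVneq j y) => [<-|].
by rewrite eq_sym (negbTE ij).
Qed.

Lemma mnm_supp_set W s : mnm_supp (set_mnm W - set_mnm s)%MM = W :\: s.
Proof.
apply/setP=> x; rewrite !inE mnmBE !set_mnmE.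
by case: (x \in W); case: (x \in s).
Qed.

Definition in_nonedge_ideal z := forall s, nonedge_ideal k G (z s).

Lemma fine_comp_nonedge z b s : in_nonedge_ideal z -> fine_comp b z s != 0 ->
  [/\ (set_mnm s <= b)%MM, (b - set_mnm s)%MM \in msupp (z s) &
     ~~ clique (mnm_supp (b - set_mnm s)%MM)].
Proof.
move=> zI; rewrite /fine_comp; case: ifP => [sb|]; last by rewrite eqxx.
rewrite -mcoeff_msupp => H; split=> //; exact: (nonedge_idealP _).1 (zI s) _ H.
Qed.

Lemma mnm_set_of b : (forall x, (b x <= 1)%N) -> b = set_mnm (mnm_supp b).
Proof.
move=> b1; apply/mnmP => x; rewrite set_mnmE inE; have := b1 x.
by case: (b x) => [|[]].
Qed.

Lemma clique0 : clique set0.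
Proof. by apply/cliqueP => x y; rewrite inE. Qed.

(* Multidegrees that are not squarefree contribute nothing, by the cone over a
   repeated variable; those of a set W contribute the cohomology of its clique
   complex. *)
Lemma cycle_boundary z i j : (forall s, koszul z s = 0) -> in_nonedge_ideal z ->
  (forall s, z s != 0 -> #|s| = i) ->
  (forall s m, m \in msupp (z s) -> (mdeg m + #|s|)%N = j) ->
  (forall W, #|W| = j -> ~ coh (j - i - 1)%N W W) ->
  exists2 y, koszul y =1 z & in_nonedge_ideal y.
Proof.
move=> z0 zI zi zj acyc.
pose Q b s := ~~ clique (mnm_supp (b - set_mnm s)%MM).
have [b|y yz yQ] := @koszul_lift k n z (fun b s => Q b s); last first.
  exists y => // s; apply/nonedge_idealP => m ms.
  have bE : (m + set_mnm s - set_mnm s)%MM = m.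
    by apply/mnmP => x; rewrite mnmBE mnmDE addnK.
  have := yQ (m + set_mnm s)%MM s; rewrite /Q /fine_comp bE => -> //.
  rewrite ifT -?mcoeff_msupp //; apply/mnm_lepP => x; by rewrite mnmDE leq_addl.
have bd0 t : bdry (fine_comp b z) t = 0.
  by rewrite -fine_comp_koszul /fine_comp z0 mcoeff0 if_same.
have [[s0 zs0]|nz] := pselect (exists s, fine_comp b z s != 0); last first.
  exists (fun _ => 0) => [s|s]; last by rewrite eqxx.
  rewrite /bdry big1 => [|x _]; last by rewrite mulr0.
  by apply/esym/eqP; apply: contrapT => /negP zs; apply: nz; exists s.
have [s0b s0m s0c] := fine_comp_nonedge zI zs0.
have zs0' : z s0 != 0 by apply: contraTneq s0m => ->; rewrite msupp0.
have bj : mdeg b = j.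
  rewrite -(zj _ _ s0m) -mdeg_set_mnm -mdegD; congr mdeg; apply/mnmP => x.
  by rewrite mnmDE mnmBE subnK //; apply: (mnm_lepP s0b).
have [[x bx]|sqf] := pselect (exists x, (1 < b x)%N).
  exists (cone x (fine_comp b z)) => s; first exact: bdry_cone.
  rewrite /cone; case: ifP => xs; rewrite ?eqxx // mulf_eq0 negb_or => /andP[_].
  move=> /(fine_comp_nonedge zI)[/mnm_lepP sb _ sc]; split.
    apply/mnm_lepP => y; have := sb y; rewrite !set_mnmE !inE.
    by case: eqVneq => [->|//] _; rewrite xs ltnW.
  (* The coefficient monomial loses one factor x but keeps x in its support, so the cone stays in
     the ideal. *)
  move: sc; rewrite /Q (_ : mnm_supp _ = mnm_supp (b - set_mnm s)%MM) //.
  apply/setP=> y; rewrite !inE !mnmBE !set_mnmE !inE.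
  by case: eqVneq => [->|//]; rewrite xs /= subn0 subn_gt0 bx ltnW.
have [W bW] : exists W, b = set_mnm W.
  exists (mnm_supp b); apply: mnm_set_of => x; rewrite leqNgt; apply/negP => bx.
  by apply: sqf; exists x.
have Wj : #|W| = j by rewrite -bj bW mdeg_set_mnm.
have supp s : fine_comp b z s != 0 -> [/\ s \subset W, ~~ clique (W :\: s) & #|s| = i].
  move=> zs; have [sb sm sc] := fine_comp_nonedge zI zs; split.
  - by rewrite -set_mnm_le -bW.
  - by move: sc; rewrite bW mnm_supp_set.
  - by apply: zi; apply: contraTneq sm => ->; rewrite msupp0.
have [s0W s0c' s0i] := supp _ zs0.
have [x xW] : exists x, x \in W.
  apply: contrapT => nx; case/negP: s0c'; suff -> : W :\: s0 = set0 by exact: clique0.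
  by apply/setP=> y; rewrite !inE; apply/negbTE/negP => /andP[_ yW]; apply: nx; exists y.
(* [eta] is a preimage over the whole polynomial ring. Its part outside the ideal lives on the s
   whose complement in W is a clique; dualized it is the cocycle [phi], and a primitive [beta] of
   [phi] corrects [eta]. *)
pose eta := cone x (fine_comp b z).
have eta_bd s : bdry eta s = fine_comp b z s := bdry_cone x s bd0.
have eta_supp s : eta s != 0 -> s \subset W.
  rewrite /eta /cone; case: ifP => xs; rewrite ?eqxx // mulf_eq0 negb_or => /andP[_].
  by case/supp; rewrite subDset setUC => /subset_trans-> //; rewrite subUset sub1set xW subxx.
pose phi t := sgW k W t * eta (W :\: t).
have etaE s : compl_dual W phi s = eta s := compl_dualK s eta_supp.
have cocycle t : t \subset W -> clique t -> cobd phi t = 0.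
  move=> tW ct; have : compl_dual W (cobd phi) (W :\: t) = 0.
    rewrite -bdry_compl_dual /bdry (eq_bigr (fun x => sg k x (W :\: t) * eta (x |: (W :\: t)))).
      rewrite -/(bdry eta _) eta_bd; apply/eqP; apply: contraT => /supp[_ + _].
      by rewrite setDDr setDv set0U (setIidPr tW) ct.
    by move=> y _; rewrite -etaE.
  rewrite compl_dualD // => /(congr1 ( *%R (sgW k W t))).
  by rewrite mulrA sgW_sqr mul1r mulr0.
have [beta betaP] : exists beta, forall t, t \subset W -> clique t ->
    #|t| = (j - i - 1)%N -> phi t = cobd beta t.
  apply: contrapT => nb; apply: (acyc W Wj); exists phi => [t tW ct _|//].
  exact: cocycle.
(* Sets of i + 1 elements are those whose complements have the j - i - 1 elements for which [beta]
   was chosen. *)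
pose g s := if #|s| == i.+1 then eta s - compl_dual W (cobd beta) s else 0.
exists g => [s|s]; last first.
  rewrite /g; case: (#|s| =P i.+1) => [si|_]; rewrite ?eqxx // => gs.
  have sW : s \subset W.
    by apply: contraNT gs => sW; rewrite -etaE /compl_dual (negbTE sW) subrr.
  split; first by rewrite bW set_mnm_le.
  rewrite /Q bW mnm_supp_set; apply: contra gs => ct.
  rewrite -etaE /compl_dual sW betaP ?subrr ?subsetDl //.
  by rewrite cardsD (setIidPr sW) Wj si; lia.
have [si|si] := eqVneq #|s| i; last first.
  have -> : fine_comp b z s = 0 by apply/eqP; apply: contraNT si => /supp[_ _ ->].
  rewrite /bdry big1 // => y ys; rewrite /g cardsU1 ys add1n eqSS (negbTE si).
  by rewrite mulr0.
rewrite -eta_bd /bdry (eq_bigr (fun y => sg k y s * eta (y |: s)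
    - sg k y s * compl_dual W (cobd beta) (y |: s))); last first.
  by move=> y ys; rewrite /g cardsU1 ys add1n si eqxx mulrBr.
rewrite sumrB -[X in _ - X]/(bdry (compl_dual W (cobd beta)) s) bdry_compl_dual.
by rewrite /compl_dual cobd_cobd mulr0 if_same subr0.
Qed.

(** The connecting map of 0 -> I -> S -> S/I -> 0 in multidegree W: the cocycle is extended by its
    values on all pairs, and its coboundary, which vanishes on cliques, dualizes to a Koszul cycle
    in the ideal. *)
Lemma boundary_cycle_of_coh2 W : coh 2 W W -> exists z,
  [/\ forall s, koszul z s = 0, in_nonedge_ideal z, 
      forall s, z s != 0 -> (#|s| + 3)%N = #|W|,
      forall s m, m \in msupp (z s) -> (mdeg m + #|s|)%N = #|W| &
      ~ exists2 y, koszul y =1 z & in_nonedge_ideal y].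
Proof.
move=> HW; have /set0Pn[x xW] := coh_neq0 HW.
case: HW => f fc fn; pose f2 t := if #|t| == 2 then f t else 0.
pose psi := compl_dual W (cobd f2).
pose z s := psi s *: 'X_[set_mnm W - set_mnm s] : {mpoly k[n]}.
have psi_supp s : psi s != 0 -> [/\ s \subset W, ~~ clique (W :\: s) & (#|s| + 3)%N = #|W|].
  rewrite /psi /compl_dual; case: ifP => [sW|_]; last by rewrite eqxx.
  rewrite mulf_eq0 negb_or => /andP[_ cs].
  have Ws3 : #|W :\: s| = 3.
    apply/eqP; apply: contraNT cs => Ws; rewrite /cobd big1 // => u us; rewrite /f2 ifN ?mulr0 //.
    by apply: contra Ws; rewrite (cardsD1 u (W :\: s)) us => /eqP ->.
  split=> //; last by rewrite -(cardsID s W) (setIidPr sW) Ws3.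
  apply: contra cs => ct; rewrite -(fc _ _ ct Ws3) ?subsetDl //.
  apply/eqP/eq_bigr => u us; rewrite /f2 ifT //.
  by move/eqP: Ws3; rewrite (cardsD1 u (W :\: s)) us add1n eqSS.
have z_supp s m : m \in msupp (z s) -> psi s != 0 /\ m = (set_mnm W - set_mnm s)%MM.
  rewrite mcoeff_msupp mcoeffZ mcoeffX mulf_eq0 negb_or => /andP[ps].
  by case: (_ =P m) => [->|_]; rewrite ?eqxx.
have WsE s : s \subset W -> (set_mnm W - set_mnm s + set_mnm s)%MM = set_mnm W.
  rewrite -set_mnm_le => /mnm_lepP sW; apply/mnmP => u.
  by rewrite mnmDE mnmBE subnK.
have zW s : fine_comp (set_mnm W) z s = psi s.
  rewrite /fine_comp set_mnm_le; case: ifP => sW; first by rewrite mcoeffZ mcoeffX eqxx mulr1.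
  by rewrite /psi /compl_dual sW.
exists z; split.
- apply: fine_comp_inj => b s; rewrite fine_comp_koszul.
  have -> : fine_comp b (fun _ => 0 : {mpoly k[n]}) s = 0 by rewrite /fine_comp mcoeff0 if_same.
  have [->|bW] := eqVneq b (set_mnm W).
    rewrite /bdry (eq_bigr (fun u => sg k u s * psi (u |: s))) => [|u _]; last by rewrite zW.
    by rewrite -/(bdry psi s) bdry_compl_dual /compl_dual cobd_cobd mulr0 if_same.
  rewrite /bdry big1 // => u _; rewrite /fine_comp; case: ifP => sb; last by rewrite mulr0.
  rewrite (memN_msupp_eq0 (p := z _)) ?mulr0 //; apply/negP => /z_supp[/psi_supp[sW _ _] e].
  case/eqP: bW; rewrite -(WsE _ sW) -e; apply/mnmP => y.
  by rewrite mnmDE mnmBE subnK //; apply: (mnm_lepP sb).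
- move=> s; apply/nonedge_idealP => m /z_supp[/psi_supp[sW cW _] ->].
  by rewrite mnm_supp_set.
- move=> s; rewrite /z scaler_eq0 negb_or => /andP[/psi_supp[]//].
- move=> s m /z_supp[/psi_supp[sW _ _] ->].
  by rewrite -mdeg_set_mnm -mdegD WsE // mdeg_set_mnm.
move=> [y yz yI]; apply: fn.
(* A cycle of the simplex. Its cone, dualized back, is a primitive of f on two-element cliques,
   where y contributes 0 because it lies in the ideal. *)
pose eta s := compl_dual W f2 s - fine_comp (set_mnm W) y s.
have eta_bd s : bdry eta s = 0.
  rewrite /bdry (eq_bigr (fun u => sg k u s * compl_dual W f2 (u |: s)
    - sg k u s * fine_comp (set_mnm W) y (u |: s))) => [|u _]; last by rewrite mulrBr.
  rewrite sumrB -!/(bdry _ s) bdry_compl_dual -fine_comp_koszul -/psi -zW.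
  by rewrite /fine_comp yz subrr.
have kappa_supp s : cone x eta s != 0 -> s \subset W.
  rewrite /cone; case: ifP => xs; rewrite ?eqxx // mulf_eq0 negb_or => /andP[_].
  suff sub u : eta u != 0 -> u \subset W.
    by move=> /sub; rewrite subDset setUC => /subset_trans-> //; rewrite subUset sub1set xW subxx.
  apply: contraNT => uW; by rewrite /eta /compl_dual /fine_comp set_mnm_le (negbTE uW) subrr.
exists (fun t => sgW k W t * cone x eta (W :\: t)) => t tW ct t2.
apply: (mulrI (x := sgW k W t)); first by apply/unitrPr; exists (sgW k W t); rewrite sgW_sqr.
rewrite -[RHS]compl_dualD // -bdry_compl_dual.
rewrite /bdry (eq_bigr (fun u => sg k u (W :\: t) * cone x eta (u |: (W :\: t)))); last first.
  by move=> u _; rewrite compl_dualK.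
rewrite -/(bdry (cone x eta) _) bdry_cone // /eta compl_dualD // /f2 t2 eqxx.
have -> : fine_comp (set_mnm W) y (W :\: t) = 0.
  apply/eqP; apply: contraTT ct => /(fine_comp_nonedge yI)[_ _].
  by rewrite mnm_supp_set setDDr setDv set0U (setIidPr tW).
by rewrite subr0.
Qed.

End NonedgeIdeal.

(** * Koszul homology and graded free resolutions *)

Section HomogeneousPart.
Variables (k : fieldType) (n : nat).
Implicit Types (p h : {mpoly k[n]}) (m : 'X_{1..n}).

(* The homogeneous part of degree j - N, which is 0 when j < N. *)
Definition hpart N j p : {mpoly k[n]} :=
  \sum_(m <- msupp p | (mdeg m + N == j)%N) p@_m *: 'X_[m].

Lemma mcoeff_hpart N j p m : (hpart N j p)@_m = if (mdeg m + N == j)%N then p@_m else 0.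
Proof.
rewrite /hpart raddf_sum /=; case: ifP => mj; last first.
  rewrite big1 // => i ij; rewrite mcoeffZ mcoeffX; case: eqP => [im|]; last by rewrite mulr0.
  by rewrite -im ij in mj.
rewrite [p in RHS]mpolyE raddf_sum /= big_mkcond; apply: eq_bigr => i _.
case: ifP => // ij; rewrite mcoeffZ mcoeffX; case: eqP => [im|]; last by rewrite mulr0.
by rewrite im mj in ij.
Qed.

Lemma hpartD N j p h : hpart N j (p + h) = hpart N j p + hpart N j h.
Proof.
by apply/mpolyP => m; rewrite mcoeffD !mcoeff_hpart mcoeffD; case: ifP; rewrite ?addr0.
Qed.

Lemma hpart0 N j : hpart N j 0 = 0.
Proof. by apply/mpolyP => m; rewrite mcoeff_hpart !mcoeff0 if_same. Qed.

Lemma hpart_sum N j I (r : seq I) (P : pred I) (F : I -> {mpoly k[n]}) :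
  hpart N j (\sum_(i <- r | P i) F i) = \sum_(i <- r | P i) hpart N j (F i).
Proof. exact: (big_morph _ (hpartD N j) (hpart0 N j)). Qed.

Lemma hpart_id N j p : hpart N j (hpart N j p) = hpart N j p.
Proof. by apply/mpolyP => m; rewrite !mcoeff_hpart; case: (_ == j). Qed.

Lemma hpartM N j d p h : {in msupp h, forall m, mdeg m = d} ->
  hpart N j (p * h) = hpart (N + d) j p * h.
Proof.
move=> hd; rewrite -{1}[p](subrK (hpart (N + d) j p)) mulrDl hpartD.
have -> : hpart N j ((p - hpart (N + d) j p) * h) = 0.
  apply/mpolyP => m; rewrite mcoeff_hpart mcoeff0; case: eqP => // mj.
  apply: memN_msupp_eq0; apply/negP => /msuppM_le /allpairsP[[m1 m2] /= [m1p m2h mE]].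
  move: m1p; rewrite mcoeff_msupp mcoeffB mcoeff_hpart ifT ?subrr ?eqxx //.
  by rewrite -mj mE mdegD (hd _ m2h) -addnA [(d + N)%N]addnC.
rewrite add0r; apply/mpolyP => m; rewrite mcoeff_hpart; case: eqP => // mj.
apply/esym; apply: memN_msupp_eq0; apply/negP => /msuppM_le /allpairsP[[m1 m2] /= [m1p m2h mE]].
move: m1p; rewrite mcoeff_msupp mcoeff_hpart; case: (_ =P j) => [m1j|]; last by rewrite eqxx.
by case: mj; rewrite mE mdegD (hd _ m2h) -m1j -addnA [(d + N)%N]addnC.
Qed.
End HomogeneousPart.

Section KoszulVectors.
Variables (k : fieldType) (n : nat).
Notation S := {mpoly k[n]}.
Implicit Types (s t : {set 'I_n}).

Lemma koszul_koszul (c : {set 'I_n} -> S) s : koszul (koszul c) s = 0.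
Proof.
rewrite /koszul; under eq_bigr do rewrite big_distrr /=.
pose F x y := sg S x s * 'X_x * (sg S y (x |: s) * 'X_y * c (y |: (x |: s))).
rewrite (eq_bigr (fun x => \sum_(y | (y \notin s) && (y != x)) F x y)); last first.
  by move=> x xs; apply: eq_bigl => y; rewrite !inE negb_or andbC.
apply: sum_antisym => x y xs ys xy; rewrite /F setUCA.
have e := sg_antiU S ys xs; rewrite eq_sym in e; have {e} := e xy.
move: (sg S y (x |: s)) (sg S x s) (sg S x (y |: s)) (sg S y s) => a b a' b' e.
transitivity (a * b * ('X_x * 'X_y * c (x |: (y |: s)))); first by ring.
by rewrite e; ring.
Qed.

Lemma koszulB (c d : {set 'I_n} -> S) s :
  koszul (fun s => c s - d s) s = koszul c s - koszul d s.
Proof. by rewrite /koszul -sumrB; apply: eq_bigr => x _; rewrite mulrBr. Qed.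

Lemma koszul_mcoeff0 (c : {set 'I_n} -> S) s : (koszul c s)@_0 = 0.
Proof.
rewrite /koszul raddf_sum big1 // => x _ /=.
by rewrite !rmorphM /= mcoeffX mnm1_eq0 mulr0 mul0r.
Qed.

Definition vkoszul r (C : {set 'I_n} -> 'rV[S]_r) s : 'rV[S]_r :=
  \row_a koszul (fun s => C s 0 a) s.

Lemma vkoszulM r r' (C : {set 'I_n} -> 'rV[S]_r) (M : 'M_(r, r')) s :
  vkoszul (fun s => C s *m M) s = vkoszul C s *m M.
Proof.
apply/rowP => b; rewrite !mxE; rewrite /koszul.
rewrite (eq_bigr (fun a => \sum_(x | x \notin s) sg S x s * 'X_x * (C (x |: s) 0 a * M a b))).
  rewrite exchange_big /=; apply: eq_bigr => x _; rewrite !mxE big_distrr /=.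
  by apply: eq_bigr => a _.
by move=> a _; rewrite !mxE big_distrl; apply: eq_bigr => x _; rewrite /= mulrA.
Qed.

End KoszulVectors.

Section VKoszul.
Variables (k : fieldType) (n : nat).
Notation S := {mpoly k[n]}.
Notation chain r := ({set 'I_n} -> 'rV[S]_r).
Implicit Types (s t : {set 'I_n}) (q j : nat).

Lemma eq_vkoszul r (C E : chain r) : C =1 E -> vkoszul C =1 vkoszul E.
Proof.
move=> CE s; apply/rowP => a; rewrite !mxE; apply: eq_bigr => x _; by rewrite CE.
Qed.

Lemma vkoszulB r (C E : chain r) s :
  vkoszul (fun s => C s - E s) s = vkoszul C s - vkoszul E s.
Proof.
apply/rowP => a; rewrite !mxE -koszulB; apply: eq_bigr => x _; by rewrite !mxE.
Qed.

Lemma vkoszulD r (C E : chain r) s :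
  vkoszul (fun s => C s + E s) s = vkoszul C s + vkoszul E s.
Proof.
apply/rowP => a; rewrite !mxE /koszul -big_split; apply: eq_bigr => x _ /=.
by rewrite !mxE mulrDr.
Qed.

Lemma vkoszul_vkoszul r (C : chain r) s : vkoszul (vkoszul C) s = 0.
Proof.
apply/rowP => a; rewrite !mxE -[RHS](koszul_koszul (fun s => C s 0 a) s).
by apply: eq_bigr => x _; rewrite !mxE.
Qed.

Lemma vkoszul_exact r (C : chain r) : (forall s, vkoszul C s = 0) ->
  (forall a, (C set0 0 a)@_0 = 0) -> exists E, vkoszul E =1 C.
Proof.
move=> C0 C00.
have /choice[E EP] a : exists d, koszul d =1 (fun s => C s 0 a).
  apply: koszul_exact; last exact: C00.
  by move=> s; have /rowP/(_ a) := C0 s; rewrite !mxE.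
exists (fun s => \row_a E a s) => s; apply/rowP => a; rewrite !mxE -EP.
by apply: eq_bigr => x _; rewrite !mxE.
Qed.

(** Component with q wedge factors and total degree j, where the basis vector a counts [dg a] and
    each wedge factor counts 1. It keeps the zigzags below homogeneous. *)
Definition proj r (dg : 'I_r -> nat) q j (C : chain r) s : 'rV[S]_r :=
  if #|s| == q then \row_a hpart (dg a + q) j (C s 0 a) else 0.

Lemma eq_proj r (dg : 'I_r -> nat) q j (C E : chain r) :
  C =1 E -> proj dg q j C =1 proj dg q j E.
Proof. by move=> CE s; rewrite /proj CE. Qed.

Lemma proj_id r (dg : 'I_r -> nat) q j (C : chain r) s :
  proj dg q j (proj dg q j C) s = proj dg q j C s.
Proof.
rewrite /proj; case: (_ == q) => //; apply/rowP => a; by rewrite !mxE hpart_id.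
Qed.

Lemma proj_vkoszul r (dg : 'I_r -> nat) q j (C : chain r) s :
  proj dg q j (vkoszul C) s = vkoszul (proj dg q.+1 j C) s.
Proof.
apply/rowP => a; rewrite /proj !mxE; case: (eqVneq #|s| q) => sq; last first.
  rewrite mxE /koszul big1 // => x xs.
  by rewrite cardsU1 xs add1n eqSS (negbTE sq) mxE mulr0.
rewrite !mxE /koszul hpart_sum; apply: eq_bigr => x xs.
rewrite cardsU1 xs add1n sq eqxx !mxE mulrC (@hpartM _ _ _ _ 1); first by rewrite addn1 addnS mulrC.
move=> m /msuppM_le /allpairsP[[m1 m2] /= [m1p]].
rewrite msuppX inE => /eqP-> ->; rewrite mdegD mdeg1.
move: m1p; rewrite (_ : sg _ _ _ = (sg k x s)%:MP); last by rewrite /sg rmorphXn rmorphN rmorph1.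
by rewrite msuppC; case: ifP => // _; rewrite inE => /eqP->; rewrite mdeg0.
Qed.

Lemma projM r r' (dg : 'I_r -> nat) (dg' : 'I_r' -> nat) (M : 'M[S]_(r, r')) q j
    (C : chain r) s :
  (forall a b, {in msupp (M a b), forall m, (mdeg m + dg' b)%N = dg a}) ->
  proj dg' q j (fun s => C s *m M) s = proj dg q j C s *m M.
Proof.
move=> Mg; rewrite /proj; case: ifP => sq; last by rewrite mul0mx.
apply/rowP => b; rewrite !mxE hpart_sum; apply: eq_bigr => a _; rewrite mxE.
have [M0|/eqP Mn] := eqVneq (M a b) 0; first by rewrite M0 !mulr0 hpart0.
have [m mM] : exists m, m \in msupp (M a b).
  by case E: (msupp (M a b)) => [|m l]; [case: Mn; apply/msuppnil0|exists m; rewrite mem_head].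
have e := Mg _ _ _ mM; rewrite (@hpartM _ _ _ _ (dg a - dg' b)) => [|m' m'M].
  by congr (hpart _ _ _ * _); rewrite -e; lia.
by rewrite -(Mg _ _ _ m'M) addnK.
Qed.

End VKoszul.

Section Staircase.
Variables (k : fieldType) (n : nat).
Notation S := {mpoly k[n]}.
Notation chain r := ({set 'I_n} -> 'rV[S]_r).
Implicit Types (s : {set 'I_n}).

Variables (rk : nat -> nat) (dg : forall i, 'I_(rk i) -> nat).
Variable D : forall i, 'M[S]_(rk i.+1, rk i).
Hypothesis D_graded : forall i a b,
  {in msupp (D i a b), forall m, (mdeg m + dg b)%N = dg a}.
Hypothesis D_exact : forall i (u : 'rV_(rk i.+1)),
  u *m D i = 0 <-> exists v, u = v *m D i.+1.
Hypothesis D_minimal : forall i a b, (D i.+1 a b)@_0 = 0.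

Notation proj := (proj (@dg _)).

Definition bounds i (C : chain (rk i.+1)) :=
  exists Y Y', forall s, C s = vkoszul Y s + Y' s *m D i.+1.

Lemma boundsP i (C Y : chain (rk i.+1)) :
  (forall s, (C s - vkoszul Y s) *m D i = 0) -> bounds C.
Proof.
move=> H; have /choice[Y' YP] s : exists v, C s - vkoszul Y s = v *m D i.+1 by apply/D_exact.
by exists Y, Y' => s; rewrite -YP addrC subrK.
Qed.

Lemma D_sq i r (u : 'M_(r, rk i.+2)) : u *m D i.+1 *m D i = 0.
Proof.
apply/row_matrixP => l; rewrite row0 !row_mul; apply/D_exact.
by exists (row l u).
Qed.

Lemma D_mcoeff0 i (u : 'rV_(rk i.+2)) a : ((u *m D i.+1) 0 a)@_0 = 0.
Proof.
rewrite mxE raddf_sum big1 // => b _ /=; by rewrite rmorphM /= D_minimal mulr0.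
Qed.

(** A zigzag in the double complex of the Koszul differential and [D]. By minimality the image of C
    under [D] has no constant terms, hence is the Koszul boundary of some E with one more wedge
    factor, one step lower in the resolution; if E bounded, so would C. *)
Lemma staircase_down t q j (C : chain (rk t.+1)) :
  proj q j C =1 C -> (forall s, vkoszul C s *m D t = 0) -> ~ bounds C ->
  exists Z : chain (rk 1), let z s := Z s *m D 0 in
    [/\ forall s, vkoszul z s = 0, proj (q + t) j z =1 z &
        ~ exists Y : chain (rk 1), forall s, z s = vkoszul (fun s => Y s *m D 0) s].
Proof.
elim: t q C => [|t IH] q C Cp Cc Cn.
  exists C; split=> [s|s|[Y YP]].
  - by rewrite vkoszulM.
  - by rewrite addn0 (projM _ _ _ _ (@D_graded 0)) Cp.
  - by apply: Cn; apply: (boundsP (Y := Y)) => s; rewrite mulmxBl YP vkoszulM subrr.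
have [E0 E0P] : exists E, vkoszul E =1 (fun s => C s *m D t.+1).
  by apply: vkoszul_exact => [s|a]; [rewrite vkoszulM|exact: D_mcoeff0].
pose E := proj q.+1 j E0.
have EP s : vkoszul E s = C s *m D t.+1.
  by rewrite -proj_vkoszul (eq_proj _ _ _ E0P) (projM _ _ _ _ (@D_graded t.+1)) Cp.
rewrite addnS -addSn; apply: (IH _ E) => [s|s|[Y [Y' YP]]]; first exact: proj_id.
  by rewrite EP D_sq.
apply: Cn; apply: (boundsP (Y := Y')) => s.
rewrite mulmxBl -EP -vkoszulM (eq_vkoszul YP) vkoszulD vkoszul_vkoszul add0r.
by rewrite subrr.
Qed.

(** The zigzag starts at the basis vector a with the empty wedge, which does not bound: neither
    Koszul boundaries nor images under [D] have constant terms. *)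
Lemma staircase_of_gen i (a : 'I_(rk i.+1)) :
  exists Z : chain (rk 1), let z s := Z s *m D 0 in
    [/\ forall s, vkoszul z s = 0, proj i (dg a) z =1 z &
        ~ exists Y : chain (rk 1), forall s, z s = vkoszul (fun s => Y s *m D 0) s].
Proof.
pose C s : 'rV[S]_(rk i.+1) := if s == set0 then delta_mx 0 a else 0.
apply: (staircase_down (q := 0) (C := C)) => [s|s|[Y [Y' YP]]].
- rewrite /proj /C; have [->|s0] := eqVneq s set0; last by rewrite cards_eq0 (negbTE s0).
  rewrite cards0 eqxx; apply/rowP => b; rewrite !mxE eqxx /= addn0.
  apply/mpolyP => m; rewrite mcoeff_hpart.
  case: (eqVneq b a) => [->|_]; last by rewrite mcoeff0 if_same.
  rewrite mcoeff1; case: (eqVneq m 0%MM) => [->|_]; last by rewrite if_same.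
  by rewrite mdeg0 add0n eqxx.
- rewrite (_ : vkoszul C s = 0) ?mul0mx //; apply/rowP => b; rewrite !mxE /koszul big1 // => x _.
  by rewrite /C ifN ?mxE ?mulr0 //; apply/set0Pn; exists x; rewrite setU11.
have := YP set0; rewrite /C eqxx => /rowP/(_ a)/(congr1 (mcoeff 0%MM)).
rewrite mxE [in RHS]mxE mcoeffD D_mcoeff0 mxE koszul_mcoeff0 !eqxx addr0 mcoeff1 eqxx.
by move/eqP; rewrite oner_eq0.
Qed.

(** The reverse zigzag lifts along the exact resolution until no wedge factor is left. Without a
    generator of degree j the final chain would have no constant terms and so be a Koszul
    boundary. *)
Lemma staircase_up q r t j (Z : chain (rk t.+1)) : r = (t.+1 + q)%N ->
  proj q j Z =1 Z -> (forall s, vkoszul Z s *m D t = 0) -> ~ bounds Z ->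
  exists a : 'I_(rk r), dg a = j.
Proof.
elim: q r t Z => [|q IH] r t Z rE Zp Zc Zn.
  rewrite addn0 in rE; subst r; apply: contrapT => na; apply: Zn.
  have Z0 s : s != set0 -> Z s = 0.
    by move=> s0; rewrite -Zp /proj cards_eq0 (negbTE s0).
  have [Y YP] : exists Y, vkoszul Y =1 Z.
    apply: vkoszul_exact => [s|a].
      apply/rowP => b; rewrite !mxE /koszul big1 // => x _.
      by rewrite Z0 ?mxE ?mulr0 //; apply/set0Pn; exists x; rewrite setU11.
    rewrite -Zp /proj cards0 eqxx mxE mcoeff_hpart mdeg0 add0n addn0.
    by case: eqP => // ja; case: na; exists a.
  by exists Y, (fun _ => 0) => s; rewrite mul0mx addr0 YP.
have /choice[E0 E0P] s : exists v, vkoszul Z s = v *m D t.+1 by apply/D_exact.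
pose E := proj q j E0.
have EP s : E s *m D t.+1 = vkoszul Z s.
  rewrite -(projM _ _ _ _ (@D_graded t.+1)) -(eq_vkoszul Zp) -proj_vkoszul.
  by apply: eq_proj => u; rewrite E0P.
apply: (IH _ t.+1 E) => [|s|s|[Y [Y' YP]]]; first by rewrite rE addnS.
- exact: proj_id.
- by rewrite -vkoszulM (eq_vkoszul EP) vkoszul_vkoszul.
apply: Zn; have [W WP] : exists W, vkoszul W =1 (fun s => Z s - Y s *m D t.+1).
  apply: vkoszul_exact => [s|a].
    by rewrite vkoszulB vkoszulM -EP YP mulmxDl D_sq addr0 subrr.
  by rewrite -Zp /proj cards0 /= sub0r mxE mcoeffN D_mcoeff0 oppr0.
by exists W, Y => s; rewrite WP subrK.
Qed.

Lemma gen_of_staircase i j (z : chain (rk 0)) :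
  (forall s, exists u, z s = u *m D 0) -> (forall s, vkoszul z s = 0) ->
  proj i j z =1 z ->
  (~ exists Y : chain (rk 1), forall s, z s = vkoszul (fun s => Y s *m D 0) s) ->
  exists a : 'I_(rk i.+1), dg a = j.
Proof.
move=> /choice[Z0 Z0P] z0 zp zn; pose Z := proj i j Z0.
have ZP s : Z s *m D 0 = z s.
  rewrite -(projM _ _ _ _ (@D_graded 0)) -zp.
  by apply: eq_proj => u; rewrite Z0P.
apply: (staircase_up (q := i) (t := 0) (Z := Z)) => [|s|s|[Y [Y' YP]]].
- by rewrite add1n.
- exact: proj_id.
- by rewrite -vkoszulM (eq_vkoszul ZP) z0.
by apply: zn; exists Y => s; rewrite -ZP YP mulmxDl D_sq addr0 vkoszulM.
Qed.

End Staircase.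

Section Resolution.
Variables (k : fieldType) (n : nat) (G : rel 'I_n).
Variable F : minimal_free_resolution (nonedge_ideal k G).
Notation S := {mpoly k[n]}.
Implicit Types (W : {set 'I_n}).

(* The resolution shifted by one, with the polynomial ring in position 0. *)
Definition aug_rank i := if i is i'.+1 then res_rank F i' else 1%N.

Definition aug_deg i : 'I_(aug_rank i) -> nat :=
  match i return 'I_(aug_rank i) -> nat with
  | 0 => fun _ => 0%N
  | i'.+1 => @res_deg _ _ _ F i'
  end.

Definition aug_diff i : 'M[S]_(aug_rank i.+1, aug_rank i) :=
  match i return 'M[S]_(aug_rank i.+1, aug_rank i) with
  | 0 => res_aug F
  | i'.+1 => res_diff F i'
  end.

Lemma aug_graded i a b : {in msupp (aug_diff i a b),
  forall m, (mdeg m + aug_deg b)%N = aug_deg a}.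
Proof.
case: i a b => [|i] a b m; last exact: res_diff_graded.
by rewrite (ord1 b) addn0; apply: res_aug_graded.
Qed.

Lemma aug_exact i (u : 'rV_(aug_rank i.+1)) :
  u *m aug_diff i = 0 <-> exists v, u = v *m aug_diff i.+1.
Proof. by case: i u => [|i] u; [apply: res_exact0|apply: res_exactS]. Qed.

Lemma aug_minimal i a b : (aug_diff i.+1 a b)@_0 = 0.
Proof. exact: res_minimal. Qed.

Lemma aug_in_ideal (u : 'rV[S]_(aug_rank 1)) : nonedge_ideal k G ((u *m aug_diff 0) 0 0).
Proof. by apply/(res_aug_onto F); exists u. Qed.

(** If no such W existed, [cycle_boundary] would give the cycle at the end of the zigzag a preimage
    in the ideal, and this lifts through the augmentation. *)
Lemma coh_of_generator i (a : 'I_(res_rank F i)) :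
  exists2 W : {set 'I_n}, #|W| = res_deg a & coh k G (res_deg a - i - 1)%N W W.
Proof.
have [Z [z0 zp zn]] := staircase_of_gen aug_graded aug_exact aug_minimal (i := i) a.
set z := fun s => Z s *m aug_diff 0 in z0 zp zn.
pose zs s : S := z s 0 0.
apply: contrapT => nW; case: zn.
have zsp s : zs s = (proj (@aug_deg 0) i (res_deg a) z s) 0 0 by rewrite zp.
have zs_card s : zs s != 0 -> #|s| = i.
  rewrite zsp /proj; case: (#|s| =P i) => // _; by rewrite mxE eqxx.
have [s|s|s m|W Wj|y yz yI] := @cycle_boundary k n G zs i (res_deg a) _ _ zs_card.
- by have /rowP/(_ 0) := z0 s; rewrite !mxE.
- exact: aug_in_ideal.
- move=> ms; have si : #|s| = i.
    by apply: zs_card; apply: contraTneq ms => ->; rewrite msupp0.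
  move: ms; rewrite zsp /proj si eqxx mxE mcoeff_msupp mcoeff_hpart add0n.
  by case: (_ =P res_deg a) => //; rewrite eqxx.
- by move=> HW; apply: nW; exists W.
have /choice[Y YP] s : exists u : 'rV_(aug_rank 1), y s = (u *m aug_diff 0) 0 0.
  exact: (res_aug_onto F (y s)).1 (yI s).
exists Y => s; apply/rowP => b; rewrite (ord1 b) [RHS]mxE -[LHS]/(zs s) -yz.
by apply: eq_bigr => x _; rewrite YP.
Qed.

(** With j = #|W|, the step i = #|W| - 3 is the solution of j - i - 1 = 2. *)
Lemma generator_of_coh2 W : (2 < #|W|)%N -> coh k G 2 W W ->
  exists a : 'I_(res_rank F (#|W| - 3)), res_deg a = #|W|.
Proof.
move=> W3 /boundary_cycle_of_coh2[zs [z0 zI zs_card zs_deg zn]].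
pose z s : 'rV[S]_1 := \row_(_ < 1) zs s.
apply: (@gen_of_staircase k n aug_rank aug_deg aug_diff aug_graded aug_exact aug_minimal
  (#|W| - 3) #|W| z).
- move=> s; have [u uE] := (res_aug_onto F (zs s)).1 (zI s).
  by exists u; apply/rowP => b; rewrite (ord1 b) mxE uE.
- move=> s; apply/rowP => b; rewrite !mxE -[RHS](z0 s).
  by apply: eq_bigr => x _; rewrite mxE.
- move=> s; rewrite /proj; apply/rowP => b.
  have [zs0|zs0] := eqVneq (zs s) 0.
    by case: ifP => _; rewrite !mxE ?zs0 ?hpart0.
  have sc := zs_card s zs0; rewrite ifT; last by apply/eqP; lia.
  rewrite !mxE; apply/mpolyP => m; rewrite mcoeff_hpart add0n.
  case: (_ =P #|W|) => // mW; apply/esym/memN_msupp_eq0/negP => /zs_deg mW'.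
  by apply: mW; rewrite -mW'; congr addn; lia.
move=> [Y YP]; apply: zn.
exists (fun s => (Y s *m aug_diff 0) 0 0) => [s|s]; last exact: aug_in_ideal.
by have /rowP/(_ 0) := YP s; rewrite !mxE => ->.
Qed.

End Resolution.

(** * Betti numbers and the logarithmic estimate *)

Lemma betti_neq0 (k : fieldType) n I i j : @betti k n I i j <> 0%N ->
  exists (F : minimal_free_resolution I) (a : 'I_(res_rank F i)), res_deg a = j.
Proof.
rewrite /betti => b0.
apply: contrapT => nF; case: b0; case: (classical_sets.xgetP 0%N) => [_ -> [F ->]|//].
apply/eqP; rewrite cards_eq0; apply/eqP/setP => a; rewrite !inE.
by apply/negbTE/negP => /eqP aj; apply: nF; exists F, a.
Qed.

(** The given resolution rules out the default value of [xget]; the one returned realizes the value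
    chosen and may be another. *)
Lemma betti_eq0 (k : fieldType) n I i j : @betti k n I i j = 0%N ->
  minimal_free_resolution I ->
  exists F : minimal_free_resolution I, forall a : 'I_(res_rank F i), res_deg a <> j.
Proof.
move=> + F0; rewrite /betti; case: (classical_sets.xgetP 0%N) => [_ -> [F ->]|nF _]; last first.
  by case: (nF #|[set a | res_deg (m := F0) (i := i) a == j]|); exists F0.
move/eqP; rewrite cards_eq0 => /eqP/setP F0'; exists F => a aj.
by have := F0' a; rewrite !inE aj eqxx.
Qed.

Section LogBounds.
Variables (R : realType) (b y : R) (e : nat).
Hypothesis b_gt1 : 1 < b.

Lemma logb_ge : b ^+ e <= y -> e%:R <= logb b y.
Proof.
have b0 : 0 < b by apply: lt_trans b_gt1.
move=> h; rewrite /logb ler_pdivlMr ?ln_gt0 // mulr_natl -lnXn // ler_ln //.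
  by rewrite posrE exprn_gt0.
by rewrite posrE; apply: lt_le_trans h; rewrite exprn_gt0.
Qed.

Lemma logb_geN : 1 <= b ^+ e * y -> - e%:R <= logb b y.
Proof.
have b0 : 0 < b by apply: lt_trans b_gt1.
have be : 0 < b ^+ e by rewrite exprn_gt0.
move=> h; have y0 : 0 < y by rewrite -(pmulr_rgt0 _ be); apply: lt_le_trans h.
rewrite /logb ler_pdivlMr ?ln_gt0 // mulNr mulr_natl -lnXn // -subr_ge0 opprK.
by rewrite addrC -lnM ?posrE // ln_ge0.
Qed.
End LogBounds.

Theorem theorem1p11 (R : realType) (k : fieldType) (char0 : [pchar k] =i pred0)
    (p : nat) (p_ge2 : (2 <= p)%N)
    (n : nat) (n_ge1 : (1 <= n)%N)
    (G : rel 'I_n) (G_sym : symmetric G) (G_irr : irreflexive G)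
    (G_N2p : property_N2 k G p) :
  (regularity R k G <=
     (logb ((p%:R + 4) / 2) (n%:R / (p%:R + 1)) + 4)%:E)%E.
Proof.
have p2 : 2 <= p%:R :> R by rewrite (ler_nat _ 2).
have n1 : 1 <= n%:R :> R by rewrite (ler_nat _ 1).
have b1 : 1 < (p%:R + 4) / 2 :> R by lra.
have p1 : 0 < p%:R + 1 :> R by lra.
rewrite /regularity; case: ifPn => Gc.
  (* For n < p + 1 the logarithm is negative. As n >= 1, it is enough that b ^ 3 >= p + 1 = 2 b - 3
     for the base b. *)
  rewrite lee_fin -lerBlDr; have -> : 1 - 4 = - 3%:R :> R by ring.
  apply: logb_geN => //; rewrite mulrA ler_pdivlMr // mul1r.
  apply: le_trans (_ : ((p%:R + 4) / 2) ^+ 3 * 1 <= _); last first.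
    by rewrite ler_wpM2l // exprn_ge0 //; lra.
  have : 3 <= (p%:R + 4) / 2 :> R by lra.
  set b := (_ / 2) => b3; have -> : p%:R + 1 = 2 * b - 3 by rewrite /b; field.
  nra.
have n2 : 2 <= n%:R :> R.
  rewrite (ler_nat _ 2) ltnNge; apply: contra Gc => n1'.
  apply/'forall_'forall_implyP => i j; rewrite -val_eqE /=.
  by have := (ltn_ord i, ltn_ord j); case=> ? ?; lia.
apply: ub_ereal_sup => _ [r [i /betti_neq0[F [a aj]]] <-]; rewrite lee_fin.
(* For i = #|W| - 3 <= p - 1 the degree #|W| = i + 3 is off the linear strand. *)
have small (W : {set 'I_n}) : (2 < #|W| < p.+3)%N -> ~ coh k G 2 W W.
  move=> /andP[W2 Wp] HW.
  have b0 : betti (nonedge_ideal k G) (#|W| - 3) #|W| = 0%N by apply: G_N2p; lia.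
  have [F' F'P] := betti_eq0 b0 F.
  have [a' a'W] := generator_of_coh2 F' W2 HW; exact: F'P a'W.
(* As n >= 2, the product b * n / (p + 1) is at least (p + 4) / (p + 1) >= 1; so the logarithm is at
   least -1 and the right-hand side at least 3. *)
have [r3|r4] := leqP r 3.
  rewrite -lerBlDr; apply: (@le_trans _ _ (- 1%:R)); last first.
    apply: logb_geN => //; rewrite expr1 mulrA ler_pdivlMr // mul1r.
    by nra.
  have : r%:R <= 3 :> R by rewrite (ler_nat _ _ 3).
  lra.
(* The index i + r - i - 1 equals (r - 4) + 3, and [card_coh_ge] starts at index 3: this is the 4 in
   the bound. *)
have [W Wc HW] := coh_of_generator a.
rewrite aj in HW; have re : (i + r - i - 1 = (r - 4).+3)%N by lia.
rewrite re in HW.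
have := card_coh_ge G_sym G_irr p_ge2 small HW.
move=> /leq_trans /(_ (max_card _)); rewrite card_ord => h.
have -> : r%:R = (r - 4)%:R + 4 :> R by rewrite -[4]/(4%:R) -natrD subnK.
rewrite lerD2r; apply: logb_ge => //; rewrite ler_pdivlMr //.
(* Factor by factor: ceil(p / 2) + 2 >= (p + 4) / 2, and (p / 2 + 1) p >= p + 1 because p ^ 2 >=
   2. *)
apply: le_trans (_ : ((uphalf p).+2 ^ (r - 4) * ((uphalf p).+1 * p))%:R <= _).
  2: by rewrite ler_nat.
have u : p%:R <= 2 * (uphalf p)%:R :> R by rewrite -natrM ler_nat; lia.
rewrite natrM natrX natrM -!(natr1 (uphalf _)) -addn1 ?natrD.
apply: ler_pM.
- by rewrite exprn_ge0 //; lra.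
- by lra.
- rewrite lerXn2r ?nnegrE //; lra.
- nra.
Qed.
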